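(* For every (finite) squaregraph $G$ there exist an outerplanar graph $H$ and a path $P$ such that $G$ is isomorphic to a subgraph of the semi-strong product $H \bowtie P$.
   Context: All graphs are finite, undirected and simple. A plane graph is a graph embedded in the plane without crossings; a vertex is inner if it is not on the outer face. A squaregraph is a plane graph in which every internal (bounded) face is bounded by a $4$-cycle and every inner vertex has degree at least $4$. A graph is outerplanar if it has a plane embedding with all vertices on the outer face. For graphs $G$ and $H$, the semi-strong product $G \bowtie H$ has vertex set $V(G)\times V(H)$, with $(v,w)$ and $(v',w')$ adjacent if either $v=v'$ and $ww'\in E(H)$, or $vv'\in E(G)$ and $ww'\in E(H)$. *)

(* Defs.v *)
(* Plane embeddings are encoded combinatorially by rotation
   systems (combinatorial maps). *)
From mathcomp Require Import all_boot fingroup perm.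
Set Implicit Arguments. Unset Strict Implicit. Unset Printing Implicit Defensive.

Section Embeddings.
Variables (T : finType) (e : rel T).

Definition simple_graph : Prop := symmetric e /\ irreflexive e.

Definition is_dart (d : T * T) : bool := e d.1 d.2.
Definition rev_dart (d : T * T) : T * T := (d.2, d.1).

Definition rotation_system (s : {perm (T * T)}) : Prop :=
  [/\ forall d, ~~ is_dart d -> s d = d,
      forall d, is_dart d -> is_dart (s d) /\ (s d).1 = d.1 &
      forall d d', is_dart d -> is_dart d' -> d.1 = d'.1 -> fconnect s d d'].

(* face permutation: the face to the right of dart (u,v) continues with the
   successor of (v,u) in the rotation at v *)
Definition face_map (s : {perm (T * T)}) (d : T * T) : T * T := s (rev_dart d).

Definition comp (v : T) : {set T} := [set w | connect e v w].
Definition comp_darts (v : T) : {set T * T} :=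
  [set d | is_dart d && (d.1 \in comp v)].
Definition comp_faces (s : {perm (T * T)}) (v : T) : nat :=
  #|[set d in comp_darts v | froot (face_map s) d == d]|.

(* Euler's formula V - E + F = 2 on every component with an edge
   (E = #darts / 2): the rotation system is a plane (genus 0) embedding *)
Definition genus0 (s : {perm (T * T)}) : Prop :=
  forall v, (exists w, e v w) ->
    (#|comp v| * 2 + comp_faces s v * 2 = #|comp_darts v| + 4)%N.

Definition plane_rotation (s : {perm (T * T)}) : Prop :=
  rotation_system s /\ genus0 s.

Definition on_outer (o : {set T * T}) (v : T) : bool :=
  [exists d in o, d.1 == v].

(* squaregraph: a plane embedding with the unbounded face designated by the
   set o of its boundary darts (exactly one face orbit in each component with
   an edge); every other (bounded) face is bounded by a 4-cycle, and every
   non-isolated vertex not on the outer face has degree >= 4 (isolated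
   vertices lie on the outer face). *)
Definition squaregraph : Prop :=
  simple_graph /\
  exists (s : {perm (T * T)}) (o : {set T * T}),
    plane_rotation s /\
    (forall d, d \in o -> is_dart d) /\
    [/\ forall d, (d \in o) = (face_map s d \in o),
        forall d d', d \in o -> d' \in o -> connect e d.1 d'.1 ->
          fconnect (face_map s) d d',
        forall d, is_dart d -> (exists d', d' \in o /\ connect e d.1 d'.1),
        forall d, is_dart d -> d \notin o ->
          fingraph.order (face_map s) d = 4 /\ uniq (map fst (orbit (face_map s) d)) &
        forall v, (exists w, e v w) -> ~~ on_outer o v ->
          4 <= #|[set w | e v w]|].

Definition outerplanar : Prop :=
  simple_graph /\
  exists s : {perm (T * T)}, plane_rotation s /\
    forall v, (exists w, e v w) ->
      exists d, is_dart d /\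
        forall w, w \in comp v ->
          exists d', fconnect (face_map s) d d' /\ d'.1 = w.

End Embeddings.

Definition semistrong (T1 T2 : finType) (e1 : rel T1) (e2 : rel T2)
  : rel (T1 * T2) :=
  fun x y => ((x.1 == y.1) && e2 x.2 y.2) || (e1 x.1 y.1 && e2 x.2 y.2).

Definition path_graph (n : nat) : rel 'I_n :=
  fun i j => (i.+1 == j :> nat) || (j.+1 == i :> nat).

(* Main.v *)
(** The vertices get levels such that adjacent levels differ by one and two lower
neighbours of a vertex span with it a square whose fourth corner is still lower.
By Gauss-Bonnet, the sum of 4 - deg - (number of outer corners) is 4 in each
component, so that there is a vertex of degree one, or one of degree two on a
single square; the levels are extended from the graph without this vertex.

Each inner vertex v is mapped to an upper neighbour that follows a lower one in
the rotation. This map is injective, as inner vertices have degree at least 4,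
so the vertices fall into paths with increasing levels, each ending on the outer
face. Contracting these paths and keeping one of several parallel edges yields H,
all of whose vertices are on the outer face. The pair of the path and the level of
a vertex is the embedding.

Planarity of H is a count: adding an edge to a submap multiplies its face
permutation by a transposition, which merges two orbits or splits one. Since the
squaregraph has genus 0, any connected spanning submap has genus 0, and all
edges added to it split faces; hence the outer face of the squaregraph lies
within one face of the submap. *)

From mathcomp Require Import all_boot fingroup perm zify.
Require Import Defs.
Set Implicit Arguments. Unset Strict Implicit. Unset Printing Implicit Defensive.

(** * Orbits of permutations *)

Lemma card_imset_le (X U U' : finType) (f : X -> U) (f' : X -> U') (A : {set X}) :
  (forall x y, x \in A -> y \in A -> f' x = f' y -> f x = f y) ->
  #|f @: A| <= #|f' @: A|.
Proof.
move=> ff; case: (set_0Vmem A) => [->|[x0 x0A]]; first by rewrite imset0 cards0.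
pose k u := f (odflt x0 [pick x in A | f' x == u]).
apply: leq_trans (leq_imset_card k (f' @: A)); apply: subset_leq_card.
apply/subsetP=> _ /imsetP[x xA ->]; apply/imsetP; exists (f' x); first exact: imset_f.
rewrite /k; case: pickP => [y /andP[yA /eqP e]|/(_ x)]; last by rewrite xA eqxx.
by apply: ff.
Qed.

(** Meant for counting orbits of permutations on two different types: [h] preserves and reflects the
    classes and meets each of them. *)
Lemma card_imset_transfer (X X' : finType) (U U' : finType) (f : X -> U)
    (f' : X' -> U') (h : X' -> X) (A : {set X}) (A' : {set X'}) :
    (forall x, x \in A' -> h x \in A) ->
    (forall x y, x \in A' -> y \in A' -> f' x = f' y <-> f (h x) = f (h y)) ->
    (forall x, x \in A -> exists2 x', x' \in A' & f x = f (h x')) ->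
  #|f @: A| = #|f' @: A'|.
Proof.
move=> hA ff onto.
have -> : f @: A = (f \o h) @: A'.
  apply/setP=> u; apply/imsetP/imsetP => [[x xA ->]|[x xA ->]].
    by have [x' x'A ->] := onto _ xA; exists x'.
  by exists (h x); rewrite ?hA.
by apply/eqP; rewrite eqn_leq !card_imset_le // => x y xA yA; case: (ff _ _ xA yA); auto.
Qed.

Section PermOrbits.
Variables (D : finType).
Implicit Types (p q : {perm D}) (X : {set D}).

Definition cyc p X := #|porbit p @: X|.

Lemma porbit_fconnect p x y : (y \in porbit p x) = fconnect p x y.
Proof.
apply/porbitP/idP => [[i ->]|/iter_findex <-]; first by rewrite permX fconnect_iter.
by exists (findex p x y); rewrite permX.
Qed.

Lemma porbit_eqP p x y : reflect (porbit p x = porbit p y) (x \in porbit p y).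
Proof. by rewrite -eq_porbit_mem; apply: eqP. Qed.

Lemma porbit_step p x : porbit p (p x) = porbit p x.
Proof. by apply/porbit_eqP; have := mem_porbit p 1 x; rewrite expg1. Qed.

Definition stable p X := forall x, x \in X -> p x \in X.

Lemma iter_stable (f : D -> D) X n x :
  (forall x, x \in X -> f x \in X) -> x \in X -> iter n f x \in X.
Proof. by move=> st xX; elim: n => //= n IH; apply: st. Qed.

Lemma porbit_ind p (P : D -> Prop) x :
  P x -> (forall y, y \in porbit p x -> P y -> P (p y)) -> forall y, y \in porbit p x -> P y.
Proof.
move=> Px Pst y /porbitP[i ->]; rewrite permX.
elim: i => //= i IH; apply: Pst => //.
by have := mem_porbit p i x; rewrite permX.
Qed.

Lemma stable_porbit p X x y : stable p X -> x \in X -> y \in porbit p x -> y \in X.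
Proof. by move=> st xX; apply: (porbit_ind (P := fun y => y \in X)) => // z _; apply: st. Qed.

Lemma stableC p X : stable p X -> stable p (~: X).
Proof.
move=> st x; rewrite !inE; apply: contra => pX.
by apply: stable_porbit st pX _; rewrite porbit_sym; have := mem_porbit p 1 x; rewrite expg1.
Qed.

Lemma stableV p X : (forall x, x \in X -> exists2 y, y \in X & p y = x) -> stable p X.
Proof.
move=> st x xX; have : stable (p^-1)%g X by move=> z /st[y yX <-]; rewrite permK.
by move/stable_porbit=> /(_ _ _ xX); apply; rewrite porbitV; apply/porbit_eqP/porbit_step.
Qed.

Lemma porbit_eq_in p q X x : stable p X -> {in X, p =1 q} -> x \in X -> porbit p x = porbit q x.
Proof.
move=> st pq xX; have E i : (p ^+ i)%g x = (q ^+ i)%g x.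
  rewrite !permX; elim: i => //= i <-; apply: pq; exact: iter_stable.
by apply/setP=> y; apply/porbitP/porbitP=> -[i ->]; exists i.
Qed.

Lemma cyc_eq_in p q X : stable p X -> {in X, p =1 q} -> cyc p X = cyc q X.
Proof.
by move=> st pq; rewrite /cyc (eq_in_imset (g := porbit q)) // => x; exact: porbit_eq_in.
Qed.

Lemma cycID p X Y : stable p X -> cyc p Y = cyc p (Y :&: X) + cyc p (Y :\: X).
Proof.
move=> st; rewrite /cyc -[in LHS](setID Y X) imsetU cardsU.
rewrite (_ : (_ @: _) :&: (_ @: _) = set0) ?cards0 ?subn0 //.
apply/setP=> c; rewrite !inE; apply/negP=> /andP[/imsetP[x xX ->] /imsetP[y yX]].
rewrite !inE in xX yX; case/andP: xX yX => _ xX /andP[yX _].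
by move/porbit_eqP; rewrite porbit_sym => /(stable_porbit st xX); apply/negP.
Qed.

Lemma cycT p X : stable p X -> #|porbits p| = cyc p X + cyc p (~: X).
Proof.
move=> st; rewrite -setTD -[in X in X + _](setTI X) -cycID //.
by rewrite /cyc /porbits; apply: eq_card => c; apply/imsetP/imsetP=> -[x _ ->]; exists x.
Qed.

(** A transposition within one orbit never leaves that orbit, so the product only refines the orbits
    of [p]. *)
Lemma tperm_porbit p x y z : y \in porbit p x ->
  porbit (tperm x y * p)%g z \subset porbit p z.
Proof.
move=> yx; apply/subsetP => w; apply: (porbit_ind (P := fun w => w \in porbit p z)).
  exact: porbit_id.
move=> u _ uz; rewrite permM.
have tu : tperm x y u \in porbit p u.
  by case: tpermP => [->|->|_ _] //; rewrite ?porbit_id // porbit_sym.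
apply/porbit_eqP; rewrite porbit_step.
by move/porbit_eqP: tu => ->; apply/porbit_eqP.
Qed.

(** The orbit count of the product [q] drops by one. As [p] is in turn [q] times the same
    transposition, the count read backwards forces [x] and [y] into one orbit of [q], and then [p]
    refines [q]. *)
Lemma tperm_merge p x y : x != y -> x \notin porbit p y ->
  [/\ #|porbits (tperm x y * p)%g|.+1 = #|porbits p|,
      forall z, porbit p z \subset porbit (tperm x y * p)%g z &
      y \in porbit (tperm x y * p)%g x].
Proof.
move=> xy nxy; set q := (tperm x y * p)%g.
have := porbits_mul_tperm p x y; rewrite nxy xy /= -/q => E1.
have pq : p = (tperm x y * q)%g by rewrite /q mulgA tperm2 mul1g.
have := porbits_mul_tperm q x y; rewrite /= -pq xy => E2.
have qxy : x \in porbit q y by apply: contraT => nq; rewrite nq in E2; lia.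
rewrite porbit_sym; split=> [|z|//]; first lia.
by rewrite {1}pq tperm_porbit // porbit_sym.
Qed.

Lemma tperm_split p x y : x != y -> x \in porbit p y ->
  #|porbits (tperm x y * p)%g| = #|porbits p|.+1.
Proof. by move=> xy pxy; have := porbits_mul_tperm p x y; rewrite pxy xy /=; lia. Qed.

End PermOrbits.

(** * Submaps *)

Section Submaps.
Variables (D : finType) (s : {perm D}) (r : D -> D).
Hypothesis rK : involutive r.
Implicit Types (A B E : {set D}).

Definition symset A := forall d, d \in A -> r d \in A.

Definition swapf A d := if (d \in A) && (r d \in A) then r d else d.

Lemma swapfK A : involutive (swapf A).
Proof.
move=> d; rewrite {2}/swapf; case: ifP => [/andP[dA rdA]|nd].
  by rewrite /swapf rK rdA dA.
by rewrite /swapf nd.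
Qed.

(* The face permutation of the submap with edge set [A]; the other darts are kept
   as markers in the corners of its faces. *)
Definition phi A : {perm D} := (perm (can_inj (swapfK A)) * s)%g.

Lemma phiE A d : symset A -> phi A d = s (if d \in A then r d else d).
Proof.
move=> sA; rewrite permM permE /swapf.
by case: ifP => [/andP[-> _]//|]; case: ifP => // /[dup] /sA ->.
Qed.

Lemma phi0 : phi set0 = s.
Proof. by apply/permP=> d; rewrite phiE ?inE // => x; rewrite inE. Qed.

Lemma symsetU A B : symset A -> symset B -> symset (A :|: B).
Proof. by move=> sA sB d; rewrite !inE => /orP[/sA ->|/sB ->//]; rewrite ?orbT. Qed.

Lemma symset_edge d : symset [set d; r d].
Proof. by move=> x; rewrite !inE => /orP[]/eqP->; rewrite ?rK eqxx ?orbT. Qed.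

Lemma phi_edge A d : symset A -> d \notin A ->
  phi (A :|: [set d; r d]) = (tperm d (r d) * phi A)%g.
Proof.
move=> sA dA; have rdA : r d \notin A by apply: contra dA => /sA; rewrite rK.
apply/permP=> x; rewrite permM !phiE //; last exact: symsetU (@symset_edge d).
rewrite !inE; case: tpermP => [->|->|/eqP/negPf-> /eqP/negPf->].
- by rewrite eqxx orbT (negPf rdA).
- by rewrite eqxx !orbT rK (negPf dA).
by rewrite ?orbF.
Qed.

Lemma card_edge A d : symset A -> d \notin A -> r d != d ->
  #|A :|: [set d; r d]| = #|A|.+2.
Proof.
move=> sA dA rd; rewrite cardsU cards2 eq_sym rd.
suff -> : A :&: [set d; r d] = set0 by rewrite cards0; lia.
apply/setP=> x; rewrite !inE; apply/negP=> /andP[xA /orP[]/eqP E]; rewrite E in xA.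
  by rewrite xA in dA.
by rewrite -[d]rK sA in dA.
Qed.

Lemma sub_edge A E d : A \subset E -> symset E -> d \in E -> A :|: [set d; r d] \subset E.
Proof. by move=> AE sE dE; rewrite subUset AE subUset !sub1set dE sE. Qed.

Notation N A := #|porbits (phi A)|.

(** Each added edge is a transposition, so two more darts bring at most one more orbit. Equality
    means that every addition splits an orbit, and splitting only refines. *)
Lemma phi_chain n A E : #|E :\: A| <= n -> symset A -> symset E -> A \subset E ->
  {in E, forall d, r d != d} ->
  2 * N E <= 2 * N A + #|E :\: A| /\
  (2 * N E = 2 * N A + #|E :\: A| -> forall z, porbit (phi E) z \subset porbit (phi A) z).
Proof.
elim: n A => [|n IH] A le sA sE AE rE.
  have /eqP -> : A == E by rewrite eqEsubset AE -setD_eq0 -cards_eq0 -leqn0.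
  by rewrite setDv cards0 addn0; split=> // _ z.
case: (set_0Vmem (E :\: A)) => [E0|[d]]; first by apply: IH => //; rewrite E0 cards0.
rewrite inE => /andP[dA dE]; have rd := rE _ dE.
have AE' := sub_edge AE sE dE; have sA' := symsetU sA (@symset_edge d).
have cA := card_edge sA dA rd.
have c1 := cardsDS AE; have c2 := cardsDS AE'; have := subset_leq_card AE'.
have [|i1 i2] // := IH _ _ sA' sE AE' rE; first lia.
have nd : d != r d by rewrite eq_sym.
have [pd|pd] := boolP (d \in porbit (phi A) (r d)).
  have := tperm_split nd pd; rewrite -phi_edge // => cN leE; split; first lia.
  move=> eqN z; apply: subset_trans (i2 _ z) _; first lia.
  by rewrite phi_edge // tperm_porbit // porbit_sym.
have [] := tperm_merge nd pd; rewrite -phi_edge // => cN _ _ leE; split; lia.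
Qed.

(* Grow a spanning forest [B] of [A] edge by edge, each step merging two orbits. *)
Lemma phi_span n A B m : #|A :\: B| <= n -> symset A -> symset B -> B \subset A ->
  {in A, forall d, r d != d} ->
  (forall z, porbit s z \subset porbit (phi B) z) ->
  #|B| + 2 * N B = 2 * #|porbits s| ->
  (forall C, symset C -> C \subset A -> (forall z, porbit s z \subset porbit (phi C) z) ->
     (forall d, d \in A -> d \in porbit (phi C) (r d)) -> N C <= m) ->
  2 * N A + 2 * #|porbits s| <= #|A| + 4 * m.
Proof.
elim: n B => [|n IH] B le sA sB BA rA sub cB con; last first.
  (* Once every edge of [A] has both darts in one orbit, [con] bounds the orbits of [phi B] by [m],
     and [phi_chain] bounds what the remaining edges add. *)
  have [all|] := boolP [forall d in A, d \in porbit (phi B) (r d)].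
    have := con B sB BA sub (fun d dA => forall_inP all d dA).
    have [] := phi_chain (leqnn _) sB sA BA rA; have := cardsDS BA.
    have := subset_leq_card BA; lia.
  rewrite negb_forall_in => /exists_inP[d dA npd].
  have dB : d \notin B.
    apply: contra npd => dB; rewrite porbit_sym; apply/porbit_eqP.
    have /(subsetP (sub _))/porbit_eqP : s (r d) \in porbit s (r d).
      by have := mem_porbit s 1 (r d); rewrite expg1.
    by rewrite -(porbit_step (phi B) d) phiE // dB => ->.
  have nd : d != r d by rewrite eq_sym rA.
  have [] := tperm_merge nd npd; rewrite -phi_edge // => cN sub' _.
  have cA := card_edge sB dB (rA _ dA).
  have BA' := sub_edge BA sA dA.
  have c1 := cardsDS BA; have c2 := cardsDS BA'; have := subset_leq_card BA'.
  move=> le'; apply: (IH _ _ sA (symsetU sB (@symset_edge d)) BA' rA) => //; try lia.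
  by move=> z; apply: subset_trans (sub _) (sub' _).
have AB : A = B by apply/eqP; rewrite eqEsubset BA -setD_eq0 -cards_eq0 -leqn0 le.
rewrite -AB in sub cB.
suff h : forall d, d \in A -> d \in porbit (phi A) (r d).
  by have := con A sA (subxx _) sub h; lia.
move=> d dA; rewrite porbit_sym; apply/porbit_eqP.
have /(subsetP (sub _))/porbit_eqP : s (r d) \in porbit s (r d).
  by have := mem_porbit s 1 (r d); rewrite expg1.
by rewrite -(porbit_step (phi A) d) phiE // dA => ->.
Qed.

Lemma phi_stable A E : symset A -> symset E -> A \subset E -> stable s E -> stable (phi A) E.
Proof.
move=> sA sE AE st d dE; rewrite phiE //; apply: st.
by case: ifP => // dA; apply/sE.
Qed.

Lemma phi_out A E : symset A -> A \subset E -> {in ~: E, phi A =1 s}.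
Proof. by move=> sA AE d; rewrite inE phiE // => dE; rewrite (contraNF (subsetP AE d) dE). Qed.

(** Two bounds meet. The edges of [E] outside [A] add at most one face each, so [A] has at least the
    number of faces that genus 0 requires; growing a spanning forest shows that it has at most that
    many. Equality in [phi_chain] then gives the inclusion of faces. *)
Lemma connected_submap A E :
  symset A -> symset E -> A \subset E -> stable s E -> {in E, forall d, r d != d} ->
  2 * cyc (phi E) E + 2 * cyc s E = #|E| + 4 ->
  (forall X : {set D}, X \subset E -> X != set0 -> stable s X ->
     (forall d, d \in A -> d \in X -> r d \in X) -> X = E) ->
  2 * cyc (phi A) E + 2 * cyc s E = #|A| + 4 /\
  forall z, porbit (phi E) z \subset porbit (phi A) z.
Proof.
move=> sA sE AE st rE gen con.
have cT C : symset C -> C \subset E -> N C = cyc (phi C) E + cyc s (~: E).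
  move=> sC CE; rewrite (cycT (phi_stable sC sE CE st)); congr (_ + _).
  apply: cyc_eq_in; last exact: phi_out.
  exact/stableC/phi_stable.
have rA : {in A, forall d, r d != d} by move=> d /(subsetP AE)/rE.
have [ch1 ch2] := phi_chain (leqnn _) sA sE AE rE.
(* The bound for a connecting submap [C] is one orbit inside [E] plus the orbits outside, where
   [phi C] is [s]. *)
have sp : 2 * N A + 2 * #|porbits s| <= #|A| + 4 * (cyc s (~: E)).+1.
  have s0 : symset set0 by move=> d; rewrite inE.
  apply: (phi_span (leqnn _) sA s0 (sub0set A) rA).
  - by move=> z; rewrite phi0.
  - by rewrite phi0 cards0.
  move=> C sC CA sub conC; rewrite cT ?(subset_trans CA) //.
  rewrite -addn1 addnC leq_add2l /cyc.
  have [->|[z zE]] := set_0Vmem E; first by rewrite imset0 cards0.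
  rewrite (_ : _ @: _ = [set porbit (phi C) z]) ?cards1 //.
  pose X := porbit (phi C) z :&: E.
  have stC : stable (phi C) E by apply: phi_stable => //; apply: subset_trans CA AE.
  have XE : X = E.
    apply: con; first exact: subsetIr.
    - by apply/set0Pn; exists z; rewrite inE zE porbit_id.
    - move=> d; rewrite !inE => /andP[/porbit_eqP dz dE]; rewrite st // andbT.
      apply/porbit_eqP; rewrite -dz; apply/porbit_eqP/(subsetP (sub _)).
      by have := mem_porbit s 1 d; rewrite expg1.
    move=> d dA; rewrite !inE => /andP[/porbit_eqP dz dE]; rewrite sE // andbT.
    by apply/porbit_eqP; rewrite -dz; apply/porbit_eqP; rewrite porbit_sym conC.
  apply/setP=> c; rewrite inE; apply/imsetP/eqP => [[d dE ->]|->]; last by exists z.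
  by rewrite -XE inE in dE; case/andP: dE => /porbit_eqP.
have cAE := cardsDS AE; have leAE := subset_leq_card AE.
have cs := cycT st; rewrite !cT // in ch1 ch2 sp.
split; first lia.
by apply: ch2; lia.
Qed.

End Submaps.

(** * First return maps *)

Section FirstReturn.
Variables (D : finType) (R : {set D}).
Implicit Types (p q : {perm D}).

Lemma iter_inj (f : D -> D) n : injective f -> injective (iter n f).
Proof. by move=> injf; elim: n => //= n IH x y /injf/IH. Qed.


(** The first point of [R] from [x] on, with fuel [n]; when the fuel runs out the current point is
    returned. *)
Fixpoint hit n p x := if n is n'.+1 then if x \in R then x else hit n' p (p x) else x.

Lemma hit_eq n p q x : {in ~: R, p =1 q} -> hit n p x = hit n q x.
Proof.
move=> pq; elim: n x => //= n IH x; case: ifP => // xR.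
by rewrite pq ?IH // inE xR.
Qed.

Lemma hitP n p x i : i < n -> iter i p x \in R ->
  exists k, [/\ k <= i, hit n p x = iter k p x, hit n p x \in R &
                forall j, j < k -> iter j p x \notin R].
Proof.
elim: n x i => // n IH x i /= lt.
case: ifP => xR; first by exists 0.
case: i lt => [|i] lt; first by rewrite /= xR.
rewrite iterSr => /(IH _ _ lt)[k [ki e kR kj]]; exists k.+1; split=> //; first by rewrite iterSr.
by move=> [|j] /=; [rewrite xR | move=> /kj; rewrite -iterSr].
Qed.

Definition ret p x := hit #|D| p (p x).

Lemma retP p x : x \in R -> ret p x \in R /\
  exists k, ret p x = iter k.+1 p x /\ forall j, 0 < j <= k -> iter j p x \notin R.
Proof.
(* The orbit is back at [x], a point of [R], after [#|porbit p x|] steps, the first of which is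
   already taken in [p x]; hence the fuel [#|D|] suffices. *)
move=> xR; have lt : #|porbit p x|.-1 < #|D|.
  by rewrite prednK ?max_card // lt0n card_porbit_neq0.
have [|k [_ e kR kj]] := hitP (p := p) (x := p x) lt.
  by rewrite -iterSr prednK ?iter_porbit // lt0n card_porbit_neq0.
split=> //; exists k; split; first by rewrite iterSr.
by case=> // j /andP[_ jk]; rewrite iterSr kj.
Qed.

(** Cancelling the shorter return time, the longer trajectory would meet [R] at the other starting
    point before its return, unless both times agree. *)
Lemma ret_inj p : {in R &, injective (ret p)}.
Proof.
move=> x y xR yR; wlog: x y xR yR / exists k k', [/\ k <= k', ret p x = iter k.+1 p x,
    ret p y = iter k'.+1 p y & forall j, 0 < j <= k' -> iter j p y \notin R].
  move=> W E; have [_ [k [ek kj]]] := retP p xR; have [_ [k' [ek' kj']]] := retP p yR.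
  case: (leqP k k') => kk; first by apply: W => //; exists k, k'.
  by symmetry; apply: W => //; exists k', k; split=> //; apply: ltnW.
case=> k [k' [kk -> -> kj]]; rewrite -(subnKC kk) -addSn iterD => /(iter_inj (perm_inj (s := p))).
case def_m: (k' - k) => [|m] //= E; have /kj : 0 < m.+1 <= k' by lia.
by rewrite /= -E xR.
Qed.

Lemma ret_orbit p x y : x \in R -> y \in R -> (y \in porbit p x) = fconnect (ret p) x y.
Proof.
move=> xR yR; apply/idP/idP => [/porbitP[i]|/iter_findex <-].
  rewrite permX; elim/ltn_ind: i x xR => -[|i] IH x xR E; first by rewrite E connect0.
  have [rR [k [ek kj]]] := retP p xR.
  have ki : k <= i.
    by rewrite leqNgt; apply/negP=> lt; have := kj i.+1; rewrite -E yR ltn0Sn lt => /(_ isT).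
  apply: connect_trans (fconnect1 _ _) _; apply: (IH (i - k)) => //; first lia.
  by rewrite ek -iterD E; congr (iter _ p x); lia.
elim: (findex _ _ _) => [|n IH] /=; first exact: porbit_id.
have iR m : iter m (ret p) x \in R by elim: m => //= m /(retP p)[].
apply/porbit_eqP; move/porbit_eqP: IH => <-.
by have [_ [k [-> _]]] := retP p (iR n); apply/porbit_eqP; rewrite -permX mem_porbit.
Qed.

End FirstReturn.

(** * Levels *)

Lemma card_fibres (T : finType) (S : {set T}) (A : {set T * T}) :
  (forall d, d \in A -> d.1 \in S) -> #|A| = \sum_(v in S) #|[set d in A | d.1 == v]|.
Proof.
move=> AS; rewrite -sum1_card (partition_big fst (fun v => v \in S)) //=.
apply: eq_bigr => v _; rewrite -sum1_card; apply: eq_bigl => d; by rewrite inE.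
Qed.

Section Levels.
Variables (T : finType) (e : rel T) (s : {perm (T * T)}).
Hypotheses (esym : symmetric e) (eirr : irreflexive e).
Implicit Types (S : {set T}) (B : {set T * T}).

(* The face through the dart (a, b) is a, b, c, d. *)
Definition square a b c d :=
  [&& s (b, a) == (b, c), s (c, b) == (c, d), s (d, c) == (d, a) & s (a, d) == (a, b)].

Definition darts_in S := [set d | [&& e d.1 d.2, d.1 \in S & d.2 \in S]].

(* [S] is the vertex set of a connected union of bounded faces and edges of the
   squaregraph, and [B] the set of darts of the bounded faces that it keeps. *)
Record disc S B : Prop := Disc {
  disc_sub : B \subset darts_in S;
  disc_square : forall a b, (a, b) \in B -> exists c d,
    [/\ square a b c d, uniq [:: a; b; c; d] &
        [/\ (b, c) \in B, (c, d) \in B & (d, a) \in B]];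
  disc_inner : forall X : {set _}, X \subset B -> X != set0 -> stable s X -> 4 <= #|X|;
  disc_conn : forall X : {set _}, X \subset S -> X != set0 ->
    (forall x y, x \in X -> y \in S -> e x y -> y \in X) -> X = S;
  (* Euler's formula, the darts that are not in [B] forming one further face *)
  disc_euler : 4 * #|S| = #|darts_in S| + #|darts_in S :\: B| + 4 }.

Definition steps S (l : T -> nat) := forall x y, x \in S -> y \in S -> e x y ->
  l x = (l y).+1 \/ l y = (l x).+1.

(** The two cases are the two orders in which [x] and [y] can be consecutive around [w]. The square
    has to be kept in [B], which makes the condition usable when a deleted vertex is put back. *)
Definition leveling S B (l : T -> nat) := steps S l /\
  forall w x y, w \in S -> x \in S -> y \in S -> e w x -> e w y -> x != y ->
    l w = (l x).+1 -> l w = (l y).+1 ->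
  exists t, l x = (l t).+1 /\
    ((x, w) \in B /\ square x w y t \/ (y, w) \in B /\ square y w x t).

(** If a closed set [X] contains a neighbour of [v], it contains all of them, and [v |: X] is closed
    in [S]. Otherwise [X] itself is closed in [S], although it misses [v]. *)
Lemma disc_conn_del S B v : disc S B -> v \in S ->
  (exists2 u, u \in S & e v u) ->
  (forall X : {set _}, X \subset S :\ v ->
     (forall x y, x \in X -> y \in S :\ v -> e x y -> y \in X) ->
     forall x y, x \in X -> y \in S -> e v x -> e v y -> y \in X) ->
  forall X : {set _}, X \subset S :\ v -> X != set0 ->
    (forall x y, x \in X -> y \in S :\ v -> e x y -> y \in X) -> X = S :\ v.
Proof.
move=> dS vS [u uS vu] nb X XS X0 cl.
have XS' : X \subset S by apply: subset_trans XS (subD1set _ _).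
have vX : v \notin X by apply/negP => /(subsetP XS); rewrite !inE eqxx.
have [/exists_inP[x xX vx]|nx] := boolP [exists x in X, e v x].
  suff <- : v |: X = S by rewrite setU1K.
  apply: (disc_conn dS).
  - by rewrite subUset sub1set vS.
  - by apply/set0Pn; exists v; rewrite setU11.
  move=> a b; rewrite !inE => /predU1P[->|aX] bS ab.
    by rewrite (nb X XS cl x b) ?orbT.
  by case: (eqVneq b v) => //= bv; apply: cl ab => //; rewrite !inE bv.
suff E : X = S by rewrite E vS in vX.
apply: (disc_conn dS) => // a b aX bS ab; apply: (cl a) => //; rewrite !inE bS andbT.
apply: contra nx => /eqP E; apply/exists_inP; exists a => //.
by rewrite -E esym.
Qed.

Lemma darts_in_del S v : darts_in (S :\ v) = [set d in darts_in S | (d.1 != v) && (d.2 != v)].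
Proof.
by apply/setP=> d; rewrite !inE; case: (d.1 == v); case: (d.2 == v); rewrite /= ?andbF ?andbT.
Qed.

(* Summing [deg + number of outer corners] over [S] gives [4 #|S| - 4]. *)
Lemma disc_positive S B : disc S B -> exists2 v, v \in S &
  #|[set d in darts_in S | d.1 == v]| + #|[set d in darts_in S :\: B | d.1 == v]| < 4.
Proof.
move=> dS; apply/exists_inP; apply: contraT; rewrite negb_exists_in => /forall_inP h.
have := disc_euler dS; rewrite (@card_fibres _ S (darts_in S)); last first.
  by move=> d; rewrite inE => /and3P[].
rewrite (@card_fibres _ S (_ :\: B)); last by move=> d; rewrite !inE => /and4P[].
rewrite -big_split /=; set u := \sum_(i in S) _ => E.
suff : 4 * #|S| <= u by lia.
by rewrite mulnC -sum_nat_const; apply: leq_sum => v /h; rewrite -leqNgt.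
Qed.

Lemma leveling0 v B : leveling [set v] B (fun=> 0).
Proof.
split=> [x y|w x y]; rewrite !inE => /eqP-> /eqP->; first by rewrite eirr.
by rewrite eirr.
Qed.

Lemma disc_isolated S B v : disc S B -> v \in S ->
  [set d in darts_in S | d.1 == v] = set0 -> S = [set v].
Proof.
move=> dS vS D0; symmetry; apply: (disc_conn dS); first by rewrite sub1set.
  by apply/set0Pn; exists v; rewrite inE.
move=> x y; rewrite inE => /eqP-> yS vy.
by have := in_set0 (v, y); rewrite -D0 !inE vS yS vy eqxx.
Qed.

(** All darts at [v] lie in [B]. The square through each of them supplies its predecessor in the
    rotation, so they form a stable set, to which [disc_inner] applies. *)
Lemma disc_all_inner S B v : disc S B -> v \in S ->
  [set d in darts_in S :\: B | d.1 == v] = set0 ->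
  [set d in darts_in S | d.1 == v] = set0 \/ 4 <= #|[set d in darts_in S | d.1 == v]|.
Proof.
move=> dS vS O0; set X := [set d in darts_in S | d.1 == v].
have XB : X \subset B.
  apply/subsetP=> d dX; apply: contraT => dB; have := in_set0 d.
  by rewrite -O0 !inE dB; move: dX; rewrite !inE => ->.
have [->|X0] := eqVneq X set0; [by left|right].
apply: (disc_inner dS) => //; apply: stableV => -[a b] abX.
have [c [d [sq _ [_ _ daB]]]] := disc_square dS (subsetP XB _ abX).
exists (a, d); last by case/and4P: sq => _ _ _ /eqP.
have := subsetP (disc_sub dS) _ daB; move: abX; rewrite !inE /= (esym d a).
by move=> /andP[/and3P[_ -> _] ->] /and3P[-> ->].
Qed.


Lemma darts_in_sym S a b : ((a, b) \in darts_in S) = ((b, a) \in darts_in S).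
Proof. by rewrite !inE /= (esym a b); congr (_ && _); apply: andbC. Qed.

(** The opposite dart [(u, v)] is not in [B] either, since its square would continue along [(v, u)].
    Euler's formula persists: one vertex counts 4, and two darts outside [B] count 2 in each
    term. *)
Lemma disc_pendant S B v u : disc S B -> v \in S ->
  (forall w, (v, w) \in darts_in S -> w = u) -> (v, u) \in darts_in S -> (v, u) \notin B ->
  disc (S :\ v) B.
Proof.
move=> dS vS vw vuD vuB; have BD := disc_sub dS.
have uvB : (u, v) \notin B.
  apply/negP=> uvB; have [c [d [_ _ [vcB _ _]]]] := disc_square dS uvB.
  by move: vuB; rewrite -(vw c) ?vcB // (subsetP BD).
have symD := darts_in_sym S.
have uv : u != v by apply/eqP=> E; move: vuD; rewrite E inE /= eirr.
have ED : darts_in (S :\ v) = darts_in S :\ (v, u) :\ (u, v).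
  apply/setP=> -[a b]; rewrite darts_in_del [LHS]inE !in_setD1 !xpair_eqE /=.
  have [abD|//] := boolP ((a, b) \in darts_in S); last by rewrite ?andbF.
  rewrite andbT /=.
  case: (eqVneq a v) => [E|_].
    by rewrite E in abD; rewrite (vw _ abD) eqxx andbF.
  case: (eqVneq b v) => [E|_]; last by rewrite ?andbF.
  by rewrite E symD in abD; rewrite (vw _ abD) eqxx.
have cD : #|darts_in S| = #|darts_in (S :\ v)|.+2.
  rewrite ED (cardsD1 (v, u) (darts_in S)) vuD (cardsD1 (u, v) (darts_in S :\ _)).
  by rewrite in_setD1 -symD vuD xpair_eqE (negPf uv).
have BD' : B \subset darts_in (S :\ v).
  apply/subsetP=> d dB; rewrite ED !in_setD1 (subsetP BD _ dB) andbT.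
  by apply/andP; split; apply: contraTneq dB => ->.
split=> //; first exact: disc_square dS.
- exact: disc_inner dS.
- have := vuD; rewrite inE => /and3P[/= evu _ uS].
  apply: (disc_conn_del dS) => //; first by exists u.
  move=> X XS cl x y xX yS vx vy; rewrite (vw y) ?inE /= ?vy ?vS ?yS //.
  rewrite -(vw x) ?inE /= ?vx ?vS //.
  by move/(subsetP XS): xX; rewrite !inE => /andP[].
have := disc_euler dS; rewrite (cardsD1 v S) vS (cardsDS BD) (cardsDS BD').
have := subset_leq_card BD'; rewrite cD add1n; move: #|_| #|_|; lia.
Qed.

(** The square through [(v, x)] returns to [v] from its only other neighbour [y]. Deleting [v]
    removes four darts, and [B] loses the four darts of the square, so the number of darts outside
    [B] is unchanged. The path from [x] over [t] to [y] keeps the rest connected. *)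
Lemma disc_corner S B v x y : disc S B -> v \in S ->
  (forall w, (v, w) \in darts_in S -> w = x \/ w = y) ->
  (v, x) \in B -> (v, y) \in darts_in S -> (v, y) \notin B ->
  exists t, [/\ square v x t y, uniq [:: v; x; t; y],
    [/\ (x, t) \in B, (t, y) \in B & (y, v) \in B] &
    disc (S :\ v) (B :\: [set d in [:: (v, x); (x, t); (t, y); (y, v)]])].
Proof.
move=> dS vS vw vxB vyD vyB; have BD := disc_sub dS.
have [t [z [sq un [xtB tzB zvB]]]] := disc_square dS vxB.
have symD := darts_in_sym S.
have zy : z = y.
  have : (v, z) \in darts_in S by rewrite symD (subsetP BD).
  by move/vw => [] // E; move: un; rewrite E /= !inE eqxx ?orbT ?andbF.
rewrite {z}zy in sq un tzB zvB; exists t; split=> //.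
set F := [:: (v, x); _; _; _]; set B' := B :\: _.
have := un; rewrite /= !inE !negb_or -!andbA => /and5P[nvx nvt nvy nxt /and3P[nxy nty _]].
have xvB : (x, v) \notin B.
  apply/negP=> xvB; have [c [d [sq' un' [vcB _ _]]]] := disc_square dS xvB.
  case: (vw c); first exact: (subsetP BD).
    by move=> E; move: un'; rewrite E /= !inE eqxx ?orbT ?andbF.
  by move=> E; move: vyB; rewrite -E vcB.
have vxD := subsetP BD _ vxB.
have DE : darts_in (S :\ v) = darts_in S :\: [set d in [:: (v, x); (x, v); (v, y); (y, v)]].
  apply/setP=> -[a b]; rewrite darts_in_del [LHS]inE in_setD in_set !in_cons !xpair_eqE in_nil orbF.
  have [abD|nD] := boolP ((a, b) \in darts_in S); last by rewrite ?andbF.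
  rewrite andbT /=; case: (eqVneq a v) => [E|nav].
    by rewrite E in abD; have [->|->] := vw _ abD; rewrite eqxx ?orbT.
  case: (eqVneq b v) => [E|_]; last by rewrite ?andbF.
  by rewrite E symD in abD; have [->|->] := vw _ abD; rewrite eqxx ?orbT.
have cardl (l : seq (T * T)) (A : {set T * T}) : uniq l -> {subset l <= A} ->
    #|A| = #|A :\: [set d in l]| + size l.
  move=> ul lA; have lA' : [set d in l] \subset A by apply/subsetP=> d; rewrite inE => /lA.
  have cl : #|[set d in l]| = size l by rewrite cardsE; apply/card_uniqP.
  by rewrite (cardsDS lA') cl subnK // -cl subset_leq_card.
have cD : #|darts_in S| = #|darts_in (S :\ v)| + 4.
  rewrite DE; apply: (cardl [:: (v, x); (x, v); (v, y); (y, v)]); last first.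
    by move=> d; rewrite !in_cons => /or4P[/eqP->|/eqP->|/eqP->|/predU1P[->|//]] //;
      rewrite symD.
  rewrite /= !inE !xpair_eqE eqxx (negPf nvx) (negPf nvy) (eq_sym x v) (negPf nvx).
  by rewrite (eq_sym y v) (negPf nvy) (negPf nxy) ?andbF.
have cB : #|B| = #|B'| + 4.
  apply: (cardl F); last by move=> d; rewrite !in_cons => /or4P[/eqP->|/eqP->|/eqP->|/predU1P[->|]].
  rewrite /= !inE !xpair_eqE (negPf nvx) (negPf nvy) (negPf nvt) (eq_sym x v) (negPf nvx).
  by rewrite (negPf nxt) (negPf nxy) (eq_sym t v) (negPf nvt) (negPf nty) ?andbF.
have B'E d : d \in B' = (d \notin F) && (d \in B) by rewrite in_setD in_set.
have BD' : B' \subset darts_in (S :\ v).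
  apply/subsetP=> d; rewrite B'E DE in_setD in_set => /andP[dF dB].
  rewrite (subsetP BD _ dB) andbT; move: dF; rewrite !in_cons !negb_or.
  move=> /and5P[-> _ _ -> _] /=; rewrite andbT.
  by apply/andP; split; apply: contraTneq dB => ->.
have sub : B' \subset B by apply: subsetDl.
split=> //.
- move=> a b; rewrite B'E => /andP[nab abB].
  have [c [d [sq' un' [bcB cdB daB]]]] := disc_square dS abB; exists c, d.
  split=> //; rewrite !B'E bcB cdB daB !andbT.
  (* The predecessor of a dart of the removed square along its face is again in that square; hence a
     square that starts outside [F] never enters [F]. *)
  have face p q p' : (p, q) \in F -> s (p, p') = (p, q) -> (p', p) \in F.
    case/and4P: sq => /eqP s1 /eqP s2 /eqP s3 /eqP s4.
    by rewrite !inE => /or4P[]/eqP[-> ->] E; [have := s4|have := s1|have := s2|have := s3];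
      rewrite -E => /perm_inj[->]; rewrite eqxx ?orbT.
  case/and4P: sq' => /eqP s1 /eqP s2 /eqP s3 /eqP s4.
  have nbc := contra (fun h => face _ _ a h s1) nab.
  have ncd := contra (fun h => face _ _ b h s2) nbc.
  by have nda := contra (fun h => face _ _ c h s3) ncd.
- by move=> X XB; apply: (disc_inner dS); apply: subset_trans XB sub.
- have := vxD; rewrite inE => /and3P[/= evx _ xS].
  have := subsetP BD _ xtB; rewrite inE => /and3P[/= ext _ tS].
  have := subsetP BD _ tzB; rewrite inE => /and3P[/= ety _ yS].
  apply: (disc_conn_del dS) => //; first by exists x.
  move=> X XS cl a b aX bS va vb.
  have bD : (v, b) \in darts_in S by rewrite inE /= vb vS bS.
  have aD : (v, a) \in darts_in S.
    by rewrite inE /= va vS; move/(subsetP XS): aX; rewrite !inE => /andP[].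
  have tS' : t \in S :\ v by rewrite !inE tS eq_sym nvt.
  have xS' : x \in S :\ v by rewrite !inE xS eq_sym nvx.
  have yS' : y \in S :\ v by rewrite !inE yS eq_sym nvy.
  case: (vw a aD) => E; subst a; case: (vw b bD) => E; subst b => //.
    by apply: (cl t) => //; apply: (cl x).
  apply: (cl t) => //; last by rewrite esym.
  by apply: (cl y) => //; rewrite esym.
move: (disc_euler dS) (subset_leq_card BD').
rewrite (cardsD1 v S) vS (cardsDS BD) (cardsDS BD') cD cB /=; move: #|S :\ v| #|darts_in _| #|B'|; clear; lia.
Qed.

Lemma square_mem S B a b c d : disc S B -> (a, b) \in B -> square a b c d ->
  [/\ (b, c) \in B, (c, d) \in B & (d, a) \in B].
Proof.
move=> dS abB; have [c' [d' [sq' _ mem]]] := disc_square dS abB => sq.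
case/and4P: sq' sq => /eqP s1 /eqP s2 _ _ /and4P[]; rewrite s1 => /eqP[<-].
by rewrite s2 => /eqP[<-].
Qed.

(** A short cycle of [s] inside [B] would be the rotation at an inner vertex of degree less than
    four. *)
Lemma disc_no2 S B p q : disc S B -> p \in B -> q \in B -> s p = q -> s q = p -> False.
Proof.
move=> dS pB qB pq qp; have := disc_inner dS (X := [set p; q]).
rewrite subUset !sub1set pB qB => /(_ isT); case/(_ _ _)/Wrap => //.
- by apply/set0Pn; exists p; rewrite !inE eqxx.
- by move=> x; rewrite !inE => /orP[]/eqP->; rewrite ?pq ?qp eqxx ?orbT.
by rewrite cards2; case: eqP.
Qed.

Lemma disc_no3 S B p q r : disc S B -> p \in B -> q \in B -> r \in B ->
  s p = q -> s q = r -> s r = p -> False.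
Proof.
move=> dS pB qB rB pq qr rp; have := disc_inner dS (X := [set p; q; r]).
rewrite !subUset !sub1set pB qB rB => /(_ isT); case/(_ _ _)/Wrap => //.
- by apply/set0Pn; exists p; rewrite !inE eqxx.
- by move=> x; rewrite !inE -orbA => /or3P[]/eqP->; rewrite ?pq ?qr ?rp eqxx ?orbT.
by rewrite cardsU cards2 cards1; case: (p != q) => //=; lia.
Qed.

(** Placed above its only neighbour, [v] has a single lower neighbour and is itself a lower
    neighbour of no vertex, so no new pair has to be checked. *)
Lemma leveling_pendant S B v u l : disc (S :\ v) B -> u \in S ->
  (forall w, w \in S -> e v w -> w = u) -> leveling (S :\ v) B l ->
  leveling S B (fun w => if w == v then (l u).+1 else l w).
Proof.
move=> dS uS vw [stl lev]; split=> [x y xS yS xy|w x y wS xS yS wx wy xNy].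
  case: (eqVneq x v) (eqVneq y v) => [Ex|xv] [Ey|yv].
  - by rewrite Ex Ey eirr in xy.
  - by rewrite Ex in xy; rewrite (vw y yS xy); left.
  - by rewrite Ey esym in xy; rewrite (vw x xS xy); right.
  by apply: stl => //; rewrite !inE ?xv ?yv.
case: (eqVneq w v) => [Ew|wv].
  by rewrite Ew in wx wy; rewrite (vw x xS wx) (vw y yS wy) eqxx in xNy.
case: (eqVneq x v) => [Ex|xv].
  by rewrite Ex esym in wx; rewrite (vw w wS wx); lia.
case: (eqVneq y v) => [Ey|yv].
  by rewrite Ey esym in wy; rewrite (vw w wS wy); lia.
move=> l1 l2; have [|||t [lt sqt]] := lev w x y _ _ _ wx wy xNy l1 l2; rewrite ?inE ?wv ?xv ?yv //.
have tS : t \in S :\ v.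
  by case: sqt => -[m /(square_mem dS m)[_ /(subsetP (disc_sub dS))]]; rewrite inE => /and3P[].
exists t; split=> //; case: (eqVneq t v) => // tv.
by rewrite tv !inE eqxx in tS.
Qed.

(** [t] cannot be above both [x] and [y]. If these have the same level, they are thus above [t], and
    [v] becomes the top of the square. Otherwise [t] is strictly between them, and [v] gets the
    level of [t]. *)
Lemma leveling_corner S B B' v x y t l : disc S B -> disc (S :\ v) B' -> v \in S ->
  (forall w, w \in S -> e v w -> w = x \/ w = y) ->
  square v x t y -> uniq [:: v; x; t; y] ->
  [/\ (v, x) \in B, (x, t) \in B, (t, y) \in B & (y, v) \in B] ->
  B' \subset B -> (x, t) \notin B' -> (t, y) \notin B' ->
  leveling (S :\ v) B' l ->
  leveling S B (fun w => if w == v then if l x == l y then (l t).+2 else l t else l w).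
Proof.
move=> dS dS' vS vw sq un [vxB xtB tyB yvB] B'B xtB' tyB' [stl lev].
have := un; rewrite /= !inE !negb_or -!andbA => /and5P[nvx nvt nvy nxt /and3P[nxy nty _]].
have BD := disc_sub dS; have BD' := disc_sub dS'.
have inS' a b : (a, b) \in B' -> [/\ a \in S :\ v, b \in S :\ v & e a b].
  by move=> /(subsetP BD'); rewrite inE => /and3P[].
have [evx _ xS] : [/\ e v x, v \in S & x \in S].
  by have := subsetP BD _ vxB; rewrite inE => /and3P[].
have [ext _ tS] : [/\ e x t, x \in S & t \in S].
  by have := subsetP BD _ xtB; rewrite inE => /and3P[].
have [ety _ yS] : [/\ e t y, t \in S & y \in S].
  by have := subsetP BD _ tyB; rewrite inE => /and3P[].
have tS' : t \in S :\ v by rewrite !inE tS eq_sym nvt.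
have xS' : x \in S :\ v by rewrite !inE xS eq_sym nvx.
have yS' : y \in S :\ v by rewrite !inE yS eq_sym nvy.
have etx : e t x by rewrite esym.
have eyt : e y t by rewrite esym.
case/and4P: (sq) => /eqP sx /eqP st /eqP sy /eqP sv.
have no2 : s (t, y) = (t, x) -> (t, x) \in B -> False.
  by move=> s1 txB; apply: (disc_no2 dS txB tyB).
(* if t is above two neighbours, then t is inner and its rotation has length at most 3 *)
have topA : l t = (l x).+1 -> l t = (l y).+1 -> False.
  move=> lx ly; have [z [_]] := lev t x y tS' xS' yS' etx ety nxy lx ly.
  rewrite (negPf xtB') => -[[]//|[ytB' sq']].
  have [/(subsetP B'B) txB _ _] := square_mem dS' ytB' sq'.
  by case/and4P: sq' => /eqP s1 _ _ _; apply: no2 s1 txB.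
(* A second lower neighbour [w] of [x] would span a square with [t], giving a lower neighbour [z] of
   [t]. As [y] is also below [t], the rotation at [t] would close up after two or three darts.
   [topC] is the mirror image. *)
have topB w : w \in S :\ v -> e x w -> t != w ->
    l x = (l t).+1 -> l t = (l y).+1 -> l x = (l w).+1 -> False.
  move=> wS' exw ntw lxt lty lxw.
  have [z [ltz]] := lev x t w xS' tS' wS' ext exw ntw lxt lxw.
  case=> -[abB' sq']; have [m1 m2 m3] := square_mem dS' abB' sq'; last by rewrite m1 in xtB'.
  case/and4P: sq' => _ _ _ /eqP sz; have [zS' _ ezt] := inS' _ _ m3.
  have txB := subsetP B'B _ abB'.
  have [Eyz|nyz] := eqVneq y z; first by apply: no2 txB; rewrite Eyz.
  rewrite esym in ezt; have [q [_]] := lev t y z tS' yS' zS' ety ezt nyz lty ltz.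
  case=> -[m sq']; have [m' _ _] := square_mem dS' m sq'; case/and4P: sq' => /eqP s1 _ _ _.
    exact: (disc_no3 dS tyB (subsetP B'B _ m') txB).
  by move: s1; rewrite sz => -[E]; rewrite E eqxx in nxy.
have topC w : w \in S :\ v -> e y w -> t != w ->
    l y = (l t).+1 -> l t = (l x).+1 -> l y = (l w).+1 -> False.
  move=> wS' eyw ntw lyt ltx lyw.
  have [z [ltz]] := lev y t w yS' tS' wS' eyt eyw ntw lyt lyw.
  case=> -[abB' sq']; first by rewrite abB' in tyB'.
  have [m1 m2 m3] := square_mem dS' abB' sq'.
  case/and4P: sq' => _ /eqP sz _ _; have [_ zS' etz] := inS' _ _ m2.
  have tzB := subsetP B'B _ m2.
  have [Exz|nxz] := eqVneq x z; first by apply: no2; rewrite ?Exz.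
  have [q [_]] := lev t x z tS' xS' zS' etx etz nxz ltx ltz.
  case=> -[m sq']; first by rewrite m in xtB'.
  have [m' _ _] := square_mem dS' m sq'; case/and4P: sq' => /eqP s1 _ _ _.
  exact: (disc_no3 dS tyB tzB (subsetP B'B _ m')).
set k := if l x == l y then _ else _; set l' := fun w => _.
have l'E a : a != v -> l' a = l a by rewrite /l' => /negPf->.
have l'v : l' v = k by rewrite /l' eqxx.
have step_x := stl x t xS' tS' ext; have step_y := stl y t yS' tS' eyt.
have kx : k = (l x).+1 \/ l x = k.+1.
  rewrite /k; case: eqP => E; last by case: step_x; auto.
  by case: step_x => E'; [left; rewrite E' | case: topA; rewrite // -E].
have ky : k = (l y).+1 \/ l y = k.+1.
  rewrite /k; case: eqP => E; last by case: step_y; auto.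
  by case: step_y => E'; [left; rewrite E' | case: topA; rewrite // E].
have nbS a : a \in S -> e v a -> (k = (l a).+1 \/ l a = k.+1) /\ a != v.
  by move=> aS va; case: (vw a aS va) => ->; rewrite eq_sym.
split=> [a b aS bS ab|w a b wS aS bS wa wb aNb].
  case: (eqVneq a v) (eqVneq b v) => [Ea|av] [Eb|bv].
  - by rewrite Ea Eb eirr in ab.
  - by rewrite Ea in ab *; rewrite l'v l'E //; have [] := nbS b bS ab.
  - by rewrite Eb esym in ab *; rewrite l'v l'E //; have [[->|->] _] := nbS a aS ab; auto.
  by rewrite !l'E //; apply: stl => //; rewrite !inE ?av ?bv.
(* The pair of lower neighbours [v] and [c] of [w]: then [x] and [y] have different levels, [c] is
   [t] by [topB] or [topC], and the restored square is the required one. *)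
have core c : c \in S -> e w c -> c != v -> e w v -> l w = k.+1 -> l w = (l c).+1 ->
    exists t0, k = (l' t0).+1 /\
      ((v, w) \in B /\ square v w c t0 \/ (c, w) \in B /\ square c w v t0).
  move=> cS wc cv; rewrite esym => vw' lw lwc.
  have cS' : c \in S :\ v by rewrite !inE cS cv.
  have nk : l x != l y.
    by apply/eqP=> E; move: lw; rewrite /k E eqxx; case: (vw w wS vw') => ->; clear -step_y E; lia.
  have kt : k = l t by rewrite /k (negPf nk).
  case: (vw w wS vw') => E; subst w.
    have lty : l t = (l y).+1 by move/eqP: nk lw; rewrite kt; clear -step_y; lia.
    exists y; rewrite l'E 1?eq_sym // kt; split=> //; left; split=> //.
    suff <- : t = c by [].
    by apply/eqP; apply: contraT => ntc; by case: (topB c cS' wc ntc); rewrite // lw kt.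
  have ltx : l t = (l x).+1 by move/eqP: nk lw; rewrite kt; clear -step_x; lia.
  exists x; rewrite l'E 1?eq_sym // kt; split=> //; right.
  suff <- : t = c by rewrite tyB /square sx st sy sv !eqxx.
  by apply/eqP; apply: contraT => ntc; by case: (topC c cS' wc ntc); rewrite // lw kt.
case: (eqVneq w v) => [Ew|wv].
  subst w; rewrite l'v; have [_ av] := nbS a aS wa; have [_ bv] := nbS b bS wb.
  rewrite !l'E // => ka kb.
  have Exy : l x = l y.
    by case: (vw a aS wa) (vw b bS wb) aNb ka kb => -> [] -> //; rewrite ?eqxx // => _ -> [->].
  have lxt : l x = (l t).+1 by case: step_x => // E; case: topA; rewrite // -Exy.
  have rot : square y v x t by rewrite /square sx st sy sv !eqxx.
  exists t; rewrite (l'E t) 1?eq_sym //.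
  case: (vw a aS wa) (vw b bS wb) aNb => -> [] ->; rewrite ?eqxx // => _; split; auto.
  by rewrite -Exy.
rewrite (l'E w) //; case: (eqVneq a v) (eqVneq b v) => [Ea|av] [Eb|bv].
- by rewrite Ea Eb eqxx in aNb.
- by subst a; rewrite l'v l'E //; apply: core.
- subst b; rewrite l'v l'E // => lwa lwk; have [t0 [kt0 D]] := core a aS wa av wb lwk lwa.
  by exists t0; split; [rewrite -kt0; clear -lwa lwk; lia | case: D; auto].
rewrite !l'E // => lwa lwb.
have [|||t0 [lt0 D]] := lev w a b _ _ _ wa wb aNb lwa lwb; rewrite ?inE ?wv ?av ?bv //.
have tv : t0 != v.
  by case: D => -[m /(square_mem dS' m)[_ /inS'[_]]]; rewrite !inE => /andP[].
exists t0; rewrite l'E //; split=> //.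
by case: D => -[m sq']; [left|right]; split=> //; apply: (subsetP B'B).
Qed.

(** The vertex of [disc_positive] is isolated, pendant, or a corner of a single square; it is
    deleted and its level is added afterwards. *)
Lemma disc_leveling n S B : #|S| <= n -> disc S B -> exists l, leveling S B l.
Proof.
elim: n S B => [|n IH] S B le dS.
  (* An empty [S] contradicts Euler's formula, because of the summand 4. *)
  by have := disc_euler dS; rewrite (eqP (_ : #|S| == 0)) -?leqn0 //; lia.
have [v vS] := disc_positive dS.
set Dv := [set d in _ | _]; set Ov := [set d in _ | _] => lt4.
have cS : #|S :\ v| <= n by move: le; rewrite (cardsD1 v) vS.
have BD := disc_sub dS.
have [O0|[[v' y]]] := set_0Vmem Ov.
  have [D0|] := disc_all_inner dS vS O0; last by rewrite -/Dv; clear -lt4; lia.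
  by exists (fun=> 0); rewrite (disc_isolated dS vS D0); apply: leveling0.
rewrite inE inE => /andP[/andP[vyB vyD] /= /eqP E]; subst v'.
have vyO : (v, y) \in Ov by rewrite !inE vyB eqxx andbT /=; rewrite inE in vyD.
have OD : Ov \subset Dv by apply/subsetP=> d; rewrite !inE => /andP[/andP[_ ->] ->].
have inD w : w \in S -> e v w -> (v, w) \in darts_in S by move=> wS vw; rewrite inE /= vw vS.
have mD w : (v, w) \in darts_in S -> (v, w) \in Dv by move=> h; rewrite in_set h eqxx.
have yS : y \in S by move: vyD; rewrite inE => /and3P[].
have O1 : 0 < #|Ov| by rewrite card_gt0; apply/set0Pn; exists (v, y).
have [/existsP[x /andP[vxD xy]]|nx] := boolP [exists x, ((v, x) \in darts_in S) && (x != y)].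
  have sub : [set (v, x); (v, y)] \subset Dv.
    by rewrite subUset !sub1set !mD.
  have c2 : #|[set (v, x); (v, y)]| = 2 by rewrite cards2 xpair_eqE (negPf xy) andbF.
  have D2 : #|Dv| <= 2 by clear -lt4 O1; lia.
  have DE : [set (v, x); (v, y)] = Dv by apply/eqP; rewrite eqEcard sub c2.
  have vw w : (v, w) \in darts_in S -> w = x \/ w = y.
    by move/mD; rewrite -DE !inE !xpair_eqE eqxx /= => /orP[]/eqP; auto.
  (* Otherwise two darts at [v], both outside [B], would already give the sum 4. *)
  have vxB : (v, x) \in B.
    apply: contraT => vxB; have := subset_leq_card (_ : [set (v, x); (v, y)] \subset Ov).
    rewrite subUset !sub1set vyO andbT in_set in_setD vxB vxD eqxx => /(_ isT).
    by rewrite c2; move: (subset_leq_card sub); rewrite c2; clear -lt4; lia.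
  have [t [sq un [xtB tyB yvB] dS']] := disc_corner dS vS vw vxB vyD vyB.
  have [l lev] := IH _ _ cS dS'.
  exists (fun w => if w == v then if l x == l y then (l t).+2 else l t else l w).
  apply: (leveling_corner dS dS' vS _ sq un _ _ _ _ lev) => //; first by auto.
  - exact: subsetDl.
  - by rewrite in_setD in_set !in_cons eqxx !orbT.
  by rewrite in_setD in_set !in_cons eqxx !orbT.
have vw w : (v, w) \in darts_in S -> w = y.
  by move=> h; apply/eqP; apply: contraR nx => wy; apply/existsP; exists w; rewrite h.
have dS' := disc_pendant dS vS vw vyD vyB; have [l lev] := IH _ _ cS dS'.
exists (fun w => if w == v then (l y).+1 else l w).
by apply: leveling_pendant lev => // w wS evw; apply: vw; apply: inD.
Qed.

End Levels.

(** * Rotation systems and squaregraphs *)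

Lemma connect_ind (T : finType) (e : rel T) (P : T -> Prop) x y :
  (forall a b, e a b -> P a -> P b) -> connect e x y -> P x -> P y.
Proof.
move=> st /connectP[p + ->]; elim: p x => //= z p IH x /andP[xz zp] Px.
by apply: (IH z) => //; apply: st Px.
Qed.

Lemma fconnect_eq_in (D : finType) (f g : D -> D) (X : {set D}) x y :
  (forall z, z \in X -> f z \in X) -> {in X, f =1 g} -> x \in X -> fconnect f x y = fconnect g x y.
Proof.
move=> st fg xX; have E i : iter i f x = iter i g x.
  by elim: i => //= i <-; apply: fg; apply: iter_stable.
apply/idP/idP => /iter_findex <-; first by rewrite E fconnect_iter.
by rewrite -E fconnect_iter.
Qed.

Lemma card_cyc (D : finType) (p : {perm D}) (X : {set D}) k : stable p X ->
  (forall x, x \in X -> #|porbit p x| = k) -> #|X| = cyc p X * k.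
Proof.
move=> st ck; rewrite /cyc -sum1_card (partition_big_imset (porbit p)) /=.
rewrite -sum_nat_const; apply: eq_bigr => _ /imsetP[x xX ->].
rewrite -(ck x xX) -sum1_card; apply: eq_bigl => y.
rewrite eq_porbit_mem; case: (boolP (y \in porbit p x)); last by rewrite andbF.
by move/(stable_porbit st xX) => ->.
Qed.

(** Links the two ways of counting faces: canonical roots, as in [comp_faces], and orbits of a
    permutation. *)
Lemma card_roots_cyc (D : finType) (p : {perm D}) (f : D -> D) (X : {set D}) :
  injective f -> stable p X -> {in X, p =1 f} ->
  #|[set d in X | froot f d == d]| = cyc p X.
Proof.
move=> injf st pf; have csym := fconnect_sym injf; set A' := [set d in X | _].
have A'X d : d \in A' -> d \in X by rewrite inE => /andP[].
have pfE x y : x \in X -> (y \in porbit p x) = fconnect f x y.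
  by move=> xX; rewrite porbit_fconnect (fconnect_eq_in _ st pf).
rewrite -[LHS](card_imset _ (@inj_id D)); symmetry.
apply: (card_imset_transfer (h := id)) => // [x y xA yA|x xX].
  split=> [->//|/porbit_eqP]; rewrite pfE ?A'X // csym => /(rootP csym).
  by move: xA yA; rewrite !inE => /andP[_ /eqP->] /andP[_ /eqP->].
have cx := connect_root (frel f) x.
have rX : froot f x \in X by rewrite -pfE // in cx; apply: stable_porbit st xX cx.
exists (froot f x); first by rewrite inE rX (root_root csym) eqxx.
by apply/porbit_eqP; rewrite pfE // csym.
Qed.

Section Rotation.
Variables (T : finType) (e : rel T) (s : {perm (T * T)}).
Hypotheses (esym : symmetric e) (eirr : irreflexive e) (rot : rotation_system e s).
Implicit Types (v w x y : T) (d : T * T).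

Notation rev := (@rev_dart T).
Notation face := (face_map s).

Lemma rev_dartK : involutive rev. Proof. by case. Qed.

Lemma is_dart_rev d : is_dart e (rev d) = is_dart e d.
Proof. exact: esym. Qed.

Lemma rev_dart_neq d : is_dart e d -> rev d != d.
Proof.
by case: d => a b; apply: contraTneq => -[->]; rewrite /is_dart /= eirr.
Qed.

Lemma rot_dart d : is_dart e d -> is_dart e (s d).
Proof. by case: rot => _ h _ /h[]. Qed.

Lemma rot_fst d : is_dart e d -> (s d).1 = d.1.
Proof. by case: rot => _ h _ /h[]. Qed.

Lemma rot_porbit d d' : is_dart e d -> is_dart e d' -> d.1 = d'.1 -> d' \in porbit s d.
Proof. by rewrite porbit_fconnect; case: rot => _ _; apply. Qed.

Lemma rot_porbit_fst d d' : is_dart e d -> d' \in porbit s d -> is_dart e d' /\ d'.1 = d.1.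
Proof.
move=> dd; apply: (porbit_ind (P := fun d' => is_dart e d' /\ d'.1 = d.1)) => //.
by move=> y _ [dy <-]; rewrite rot_dart ?rot_fst.
Qed.

Lemma face_inj : injective face.
Proof. by move=> x y /perm_inj/(can_inj rev_dartK). Qed.

Lemma in_comp v w : (w \in comp e v) = connect e v w. Proof. by rewrite inE. Qed.

Lemma csym : connect_sym e. Proof. exact: sym_connect_sym. Qed.

Lemma comp_edge v x y : e x y -> (x \in comp e v) = (y \in comp e v).
Proof.
by move=> xy; rewrite !in_comp; apply: (same_connect_r csym); apply: connect1.
Qed.

Lemma comp_nonisolated v w : (exists x, e v x) -> w \in comp e v -> exists x, e w x.
Proof.
move=> nv; rewrite in_comp => vw; move: nv.
by apply: (connect_ind (P := fun w => exists x, e w x)) vw => a b ab _; exists a; rewrite esym.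
Qed.

Lemma comp_darts_rot v : stable s (comp_darts e v).
Proof. by move=> d; rewrite !inE => /andP[dd dv]; rewrite rot_dart ?rot_fst. Qed.

Lemma comp_darts_rev v : symset rev (comp_darts e v).
Proof.
move=> d; rewrite !inE is_dart_rev => /andP[dd dv]; rewrite dd /=.
by have := comp_edge v dd; rewrite !inE /= => <-.
Qed.

Lemma darts_in_comp v : darts_in e (comp e v) = comp_darts e v.
Proof.
apply/setP=> d; rewrite !inE -/(is_dart e d); case dd: (is_dart e d) => //=.
by have := comp_edge v dd; rewrite !inE => <-; rewrite andbb.
Qed.

Lemma comp_faces_cyc v :
  comp_faces e s v = cyc (phi s rev_dartK (comp_darts e v)) (comp_darts e v).
Proof.
apply: card_roots_cyc; first exact: face_inj.
  apply: phi_stable => //; [exact: comp_darts_rev|exact: comp_darts_rev|exact: comp_darts_rot].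
by move=> d dv; rewrite phiE ?dv //; apply: comp_darts_rev.
Qed.

(** No vertex of the component is isolated, so each one is the start of exactly one rotation
    orbit. *)
Lemma comp_cyc v : (exists w, e v w) -> #|comp e v| = cyc s (comp_darts e v).
Proof.
move=> nv; rewrite -[LHS](card_imset _ (@inj_id T)).
have /fin_all_exists[g gP] : forall w, exists d, w \in comp e v -> is_dart e d /\ d.1 = w.
  move=> w; have [wv|] := boolP (w \in comp e v); last by exists (w, w).
  by have [x wx] := comp_nonisolated nv wv; exists (w, x).
symmetry; apply: (card_imset_transfer (h := g)).
- by move=> w wv; have [dd E] := gP w wv; rewrite inE dd E.
- move=> x y xv yv; have [dx Ex] := gP x xv; have [dy Ey] := gP y yv.
  split=> [->//|/porbit_eqP/(rot_porbit_fst dy)[_]]; by rewrite Ex Ey.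
move=> d; rewrite inE => /andP[dd dv]; exists d.1 => //.
have [dd' E] := gP _ dv; apply/porbit_eqP.
by apply: rot_porbit.
Qed.

End Rotation.

(** * Discs and levels in a squaregraph *)

Section Squaregraph.
Variables (T : finType) (e : rel T) (s : {perm (T * T)}) (o : {set T * T}).
Hypotheses (esym : symmetric e) (eirr : irreflexive e).
Hypotheses (rot : rotation_system e s) (gen : genus0 e s).
Notation rev := (@rev_dart T).
Notation face := (face_map s).
Notation phiC v := (phi s (@rev_dartK T) (comp_darts e v)).
Hypotheses (o_dart : forall d, d \in o -> is_dart e d)
  (o_face : forall d, (d \in o) = (face d \in o))
  (o_one : forall d d', d \in o -> d' \in o -> connect e d.1 d'.1 -> fconnect face d d')
  (o_each : forall d, is_dart e d -> exists d', d' \in o /\ connect e d.1 d'.1)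
  (quad : forall d, is_dart e d -> d \notin o ->
     fingraph.order face d = 4 /\ uniq (map fst (orbit face d)))
  (inner_deg : forall v, (exists w, e v w) -> ~~ on_outer o v -> 4 <= #|[set w | e v w]|).

Definition inner v := [exists w, e v w] && ~~ on_outer o v.

Lemma inner_stable v d (X : {set T * T}) : inner v -> is_dart e d -> d.1 = v -> d \in X ->
  stable s X -> 4 <= #|X|.
Proof.
case/andP=> /existsP nv ov dd dv dX st; apply: leq_trans (inner_deg nv ov) _.
rewrite -(card_imset _ (_ : injective (pair v))); last by move=> a b [].
apply/subset_leq_card/subsetP=> _ /imsetP[w + ->]; rewrite inE => vw.
by apply: stable_porbit st dX _; apply: (rot_porbit rot).
Qed.

Lemma comp_squares v a b : (a, b) \in comp_darts e v :\: o -> exists c d,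
  [/\ square s a b c d, uniq [:: a; b; c; d] &
    [/\ (b, c) \in comp_darts e v :\: o, (c, d) \in comp_darts e v :\: o
      & (d, a) \in comp_darts e v :\: o]].
Proof.
set B := comp_darts e v :\: o => abB.
have Bface d : d \in B -> face d \in B.
  rewrite /B !in_setD -o_face => /andP[-> dv].
  by apply: (comp_darts_rot rot); apply: comp_darts_rev.
have Bdart d : d \in B -> is_dart e d by rewrite !inE => /andP[_ /andP[]].
have face1 d : d \in B -> (face d).1 = d.2.
  by move/Bdart=> dd; rewrite (rot_fst rot) ?is_dart_rev.
have [o4] : fingraph.order face (a, b) = 4 /\ uniq (map fst (orbit face (a, b))).
  by apply: quad; [apply: Bdart | move: abB; rewrite in_setD => /andP[]].
have := iter_order (@face_inj _ s) (a, b); rewrite /orbit o4 /=.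
have := Bface _ abB; have := face1 _ abB; case E1: (face (a, b)) => [b' c] /= Eb bcB; subst b'.
have := Bface _ bcB; have := face1 _ bcB; case E2: (face (b, c)) => [c' d] /= Ec cdB; subst c'.
have := Bface _ cdB; have := face1 _ cdB; case E3: (face (c, d)) => [d' a'] /= Ed daB; subst d'.
have := face1 _ daB => /= Ea E4 un; rewrite E4 /= in Ea; subst a'.
exists c, d; split=> //; apply/and4P.
by move: E1 E2 E3 E4; rewrite /face_map /= => -> -> -> ->.
Qed.

(** The component has [#|B| / 4] bounded faces and one outer face; inserting this number of faces
    into the genus 0 equation and doubling yields [disc_euler]. *)
Lemma comp_disc v : (exists w, e v w) -> disc e s (comp e v) (comp_darts e v :\: o).
Proof.
move=> nv; split.
- by rewrite darts_in_comp //; apply: subsetDl.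
- exact: comp_squares.
- move=> X XB /set0Pn[d dX] st.
  have dd x : x \in X -> is_dart e x.
    by move/(subsetP XB); rewrite !inE => /andP[_ /andP[]].
  apply: (@inner_stable d.1 d) => //; last by apply: dd.
  apply/andP; split; first by apply/existsP; exists d.2; apply: dd.
  apply/negP=> /exists_inP[d' d'o /eqP d'd].
  have /(subsetP XB) : d' \in X.
    by apply: (stable_porbit st dX); apply: (rot_porbit rot); [apply: dd|apply: o_dart|].
  by rewrite inE d'o.
- move=> X XS /set0Pn[x xX] cl; apply/eqP; rewrite eqEsubset XS; apply/subsetP=> y.
  have := subsetP XS _ xX; rewrite !in_comp => vx vy.
  have xy : connect e x y by apply: connect_trans vy; rewrite csym.
  apply: (connect_ind (P := fun y => y \in X)) xy xX => a b ab aX.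
  by apply: (cl a) => //; rewrite -(comp_edge _ _ ab) // (subsetP XS).
rewrite darts_in_comp //; set E := comp_darts e v; set B := E :\: o.
have stE : stable (phiC v) E.
  by apply: phi_stable => //; [exact: comp_darts_rev|exact: comp_darts_rev|exact: comp_darts_rot].
have phiF : {in E, phiC v =1 face}.
  by move=> d dE; rewrite phiE ?dE //; apply: comp_darts_rev.
have BE : B \subset E by apply: subsetDl.
have stB : stable (phiC v) B.
  move=> d; rewrite !in_setD => /andP[dO dE]; rewrite stE // andbT.
  by rewrite phiF // -o_face.
have cB : #|B| = cyc (phiC v) B * 4.
  apply: card_cyc => // d dB; have dE := subsetP BE _ dB.
  have [<- _] : fingraph.order face d = 4 /\ uniq (map fst (orbit face d)).
    by apply: quad; move: dB; rewrite !inE => /and3P[].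
  apply: eq_card => d'; rewrite porbit_fconnect (fconnect_eq_in _ (X := E) (g := face)) //.
have cO : cyc (phiC v) (E :\: B) = 1.
  have [w vw] := nv; have [d [dO vd]] := o_each (d := (v, w)) vw.
  have dB : d \in E :\: B by rewrite !inE dO o_dart.
  rewrite /cyc (_ : _ @: _ = [set porbit (phiC v) d]) ?cards1 //.
  apply/setP=> c; rewrite inE; apply/imsetP/eqP => [[d' d'B ->]|->]; last by exists d.
  have d'E : d' \in E by move: d'B; rewrite inE => /andP[].
  have d'O : d' \in o by move: d'B; rewrite in_setD d'E andbT /B in_setD d'E andbT negbK.
  apply/porbit_eqP; rewrite porbit_fconnect (fconnect_eq_in _ (X := E) (g := face)) //; last first.
    by move: dB; rewrite inE => /andP[].
  apply: o_one => //; apply: (connect_trans (y := v)); first by rewrite csym.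
  by move: d'E; rewrite !inE => /andP[].
have := gen nv; rewrite comp_faces_cyc // -/E (cycID E stB) cO.
rewrite (setIidPr BE); move: cB (cardsDS BE) (subset_leq_card BE); clear.
move: #|B| #|E :\: B| #|E| #|comp e v| (cyc _ _); clear; lia.
Qed.

Definition level_steps (l : T -> nat) := forall x y, e x y -> l x = (l y).+1 \/ l y = (l x).+1.

Definition level_tops (l : T -> nat) := forall w x y, e w x -> e w y -> x != y ->
  l w = (l x).+1 -> l w = (l y).+1 ->
  exists t, l x = (l t).+1 /\ (square s x w y t \/ square s y w x t).

Lemma square_edges a b c d : e a b -> square s a b c d -> [/\ e b c, e c d & e d a].
Proof.
rewrite esym => ba /and4P[/eqP s1 /eqP s2 /eqP s3 _].
have bc : e b c by have := rot_dart rot (d := (b, a)) ba; rewrite s1.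
have cd : e c d by have := rot_dart rot (d := (c, b)); rewrite s2 /is_dart /= esym; apply.
by split=> //; have := rot_dart rot (d := (d, c)); rewrite s3 /is_dart /= esym; apply.
Qed.

(** The components are levelled independently, each through its canonical root. *)
Lemma squaregraph_levels : exists l, level_steps l /\ level_tops l.
Proof.
have /fin_all_exists[L LP] : forall v, exists l, (exists w, e v w) ->
    leveling e s (comp e v) (comp_darts e v :\: o) l.
  move=> v; have [/existsP nv|nv] := boolP [exists w, e v w]; last first.
    by exists (fun=> 0) => /existsP nv'; rewrite nv' in nv.
  by have [l lev] := disc_leveling esym eirr (leqnn _) (comp_disc nv); exists l.
pose l v := L (root e v) v; exists l.
have rootP v w : e v w -> exists x, e (root e v) x.
  by move=> vw; apply: (comp_nonisolated esym _ (_ : _ \in comp e v));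
    [exists w | rewrite in_comp connect_root].
have compr v : v \in comp e (root e v) by rewrite in_comp csym // connect_root.
have nbr v w : e v w -> root e w = root e v.
  by move=> vw; apply/eqP; rewrite (root_connect (csym esym)) connect1 // esym.
split=> [x y xy|w x y wx wy xNy]; rewrite /l.
  have [st _] := LP _ (rootP _ _ xy); rewrite (nbr _ _ xy); apply: st => //.
  by rewrite -(nbr _ _ xy).
have [_ lev] := LP _ (rootP _ _ wx); rewrite (nbr _ _ wx) (nbr _ _ wy) => lx ly.
have [|||t [lt sq]] := lev w x y _ _ _ wx wy xNy lx ly => //.
- by rewrite -(nbr _ _ wx).
- by rewrite -(nbr _ _ wy).
(* The corner [t] lies in the component of [w], so that its level comes from the same function. *)
exists t; have tx : e t x \/ e t y.
  rewrite esym in wx; rewrite esym in wy.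
  by case: sq => -[_ /square_edges]; [move=> /(_ wx)|move=> /(_ wy)]; case; auto.
have -> : root e t = root e w by case: tx => /nbr <-; [exact: nbr wx | exact: nbr wy].
by split=> //; case: sq => -[_ sq]; auto.
Qed.

Lemma inner_iter v d k : inner v -> is_dart e d -> d.1 = v -> 0 < k < 4 -> iter k s d != d.
Proof.
move=> iv dd dv /andP[k0 k4]; apply/eqP=> kd; pose X := [set iter i s d | i : 'I_k].
suff : 4 <= #|X|.
  by move=> le4; have := leq_trans le4 (leq_imset_card _ _); rewrite card_ord; clear -k4; lia.
apply: (inner_stable iv dd dv); first by apply/imsetP; exists (Ordinal k0).
move=> _ /imsetP[i _ ->]; case: (ltnP i.+1 k) => ik.
  by apply/imsetP; exists (Ordinal ik).
apply/imsetP; exists (Ordinal k0) => //=; rewrite -[RHS]kd -iterS; congr (iter _ s d).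
by apply/eqP; rewrite eqn_leq ik ltn_ord.
Qed.

(** * Choosing an upper neighbour of each inner vertex *)

Section Next.
Variables (l : T -> nat) (lstep : level_steps l) (ltop : level_tops l).

(** The last alternative is for a vertex without lower neighbours, where any neighbour may be
    chosen. *)
Definition next_spec v x := [/\ e v x, l x = (l v).+1 &
  (exists y, [/\ e v y, l v = (l y).+1 & s (v, y) = (v, x)]) \/
  (forall y, e v y -> l y = (l v).+1)].

(* The lower neighbours of v are pairwise consecutive in the rotation of length
   at least 4, so that an upper neighbour follows one of them. *)
Lemma next_exists v : inner v -> exists x, next_spec v x.
Proof.
move=> iv; have /andP[/existsP[x0 vx0] _] := iv.
have up x : e v x -> l v != (l x).+1 -> l x = (l v).+1.
  by move=> vx; case: (lstep vx) => ->; rewrite ?eqxx.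
have [/existsP[y0 /andP[vy0 /eqP ly0]]|no] := boolP [exists y, e v y && (l v == (l y).+1)]; last first.
  have all y : e v y -> l y = (l v).+1.
    by move=> vy; apply: up => //; apply: contra no => ly; apply/existsP; exists y; rewrite vy.
  by exists x0; split=> //; [apply: all | right].
have [/existsP[y /and3P[vy /eqP ly]]|no] :=
    boolP [exists y, [&& e v y, l v == (l y).+1 & l v != (l (s (v, y)).2).+1]].
  have := rot_dart rot (d := (v, y)) vy; have := rot_fst rot (d := (v, y)) vy.
  case E: (s (v, y)) => [v' x] /= Ev vx lx; subst v'.
  by exists x; split=> //; [apply: up | left; exists y].
have lower y : e v y -> l v = (l y).+1 -> exists z, [/\ s (v, y) = (v, z), e v z & l v = (l z).+1].
  move=> vy ly; have := rot_dart rot (d := (v, y)) vy; have := rot_fst rot (d := (v, y)) vy.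
  case E: (s (v, y)) => [v' x] /= Ev vx; subst v'; exists x; split=> //.
  apply/eqP; apply: contraR no => lx; apply/existsP; exists y.
  by rewrite vy ly eqxx /= -ly E.
have [y1 [s0 vy1 ly1]] := lower _ vy0 ly0; have [y2 [s1 vy2 ly2]] := lower _ vy1 ly1.
have d0 : is_dart e (v, y0) by [].
have n2 := inner_iter (k := 2) iv d0 erefl isT; have n3 := inner_iter (k := 3) iv d0 erefl isT.
have n1 := inner_iter (k := 1) iv (d := (v, y1)) vy1 erefl isT.
rewrite /= s0 s1 in n1 n2 n3.
(* [y0], [y1], [y2] are successive lower neighbours. As [y0] and [y2] must also be consecutive, the
   rotation would have a fixed dart or close up after three steps. *)
have y02 : y0 != y2 by apply: contra n2 => /eqP->.
have [t [_ [|]]] := ltop vy0 vy2 y02 ly0 ly2; case/and4P=> /eqP st _ _ _.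
  by rewrite s0 in st; rewrite st eqxx in n1.
by rewrite st eqxx in n3.
Qed.

(** Distinct [a] and [b] below [x] span a square, in which [x] is followed by a lower neighbour [t]
    around [b], say. By the choice at [b] it is also preceded by a lower neighbour [y]. Since [y]
    and [t] must be consecutive, the rotation at [b] would have length three. *)
Lemma next_inj a b x : inner a -> inner b -> next_spec a x -> next_spec b x -> a = b.
Proof.
move=> ia ib na nb; apply/eqP; apply: contraT => nab.
wlog [t [lt sq]] : a b ia ib na nb nab / exists t, l a = (l t).+1 /\ square s a x b t.
  move=> W; case: (na) (nb) => ax lx _ [bx lx' _].
  have [||t [lt [sq|sq]]] := ltop (w := x) (x := a) (y := b) _ _ nab lx lx';
    rewrite 1?esym //; first by apply: (W a b) => //; exists t.
  apply: (W b a) => //; first by rewrite eq_sym.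
  by exists t; split=> //; rewrite -lt; move: lx'; rewrite lx => -[].
case: (na) (nb) => ax lx _ [bx lx' alt].
have [_ bt _] := square_edges ax sq; case/and4P: sq => _ /eqP st _ _.
have lbt : l b = (l t).+1 by rewrite -lt; move: lx'; rewrite lx => -[].
case: alt => [[y [by_ ly sy]]|/(_ t bt)]; last by rewrite lbt; clear; lia.
have db : is_dart e (b, y) by [].
have n2 := inner_iter (k := 2) ib db erefl isT; have n3 := inner_iter (k := 3) ib db erefl isT.
rewrite /= sy st in n2 n3.
have yt : y != t by apply: contra n2 => /eqP->.
have [q [_ [|]]] := ltop by_ bt yt ly lbt; case/and4P=> /eqP sq _ _ _.
  by move: sq; rewrite sy => -[E]; move: lx'; rewrite E lbt; clear; lia.
by rewrite sq eqxx in n3.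
Qed.

End Next.

End Squaregraph.

(** * Contraction of vertical paths *)

Section Fibres.
Variables (T : finType) (inn : pred T) (l : T -> nat) (nxt : T -> T).
Hypotheses (nxt_level : forall v, inn v -> l (nxt v) = (l v).+1)
  (nxt_inj : {in inn &, injective nxt}).

Definition step v := if inn v then nxt v else v.

(* Levels increase along nxt, so that this many steps reach a fixed point. *)
Definition tip v := iter (\max_v l v).+1 step v.

Lemma next_ind (P : T -> Prop) : (forall v, ~~ inn v -> P v) ->
  (forall v, inn v -> P (nxt v) -> P v) -> forall v, P v.
Proof.
move=> P0 P1 v; have [n] := ubnP (\max_w l w - l v); elim: n v => // n IH v lt.
have [iv|/P0 //] := boolP (inn v); apply: P1 => //; apply: IH.
have := leq_bigmax (F := l) (nxt v); rewrite nxt_level //; move: lt; clear; lia.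
Qed.

Lemma iter_step_level n v : ~~ inn (iter n step v) \/ l (iter n step v) = l v + n.
Proof.
elim: n => [|n [nin|IH]] /=; first by right; rewrite addn0.
  by left; rewrite /step (negPf nin).
rewrite {1 3}/step; case: ifP => [i|->]; [right|by left].
by rewrite nxt_level // IH addnS.
Qed.

Lemma tip_noninner v : ~~ inn (tip v).
Proof.
have [//|E] := iter_step_level (\max_v l v).+1 v.
by have := leq_bigmax (F := l) (tip v); rewrite E; clear; lia.
Qed.

Lemma tip_id v : ~~ inn v -> tip v = v.
Proof. by move=> nv; rewrite /tip; elim: _.+1 => //= n ->; rewrite /step (negPf nv). Qed.

Lemma tip_next v : inn v -> tip (nxt v) = tip v.
Proof.
move=> iv; have -> : nxt v = step v by rewrite /step iv.
by rewrite /tip -iterSr iterS -/(tip v) /step (negPf (tip_noninner v)).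
Qed.

(** Both vertices climb in step until they reach the tip together, since inner vertices are strictly
    below their tips; injectivity of [nxt] carries equality back down. *)
Lemma tip_inj v w : tip v = tip w -> l v = l w -> v = w.
Proof.
have tipl u : l u <= l (tip u) /\ (inn u -> l u < l (tip u)).
  move: u; apply: next_ind => [u nu|u iu [IH _]]; first by rewrite tip_id // (negPf nu).
  by rewrite -(tip_next iu); move: IH; rewrite nxt_level //; clear; lia.
move: v w; apply: (next_ind (P := fun v => forall w, _ -> _ -> _)) => [v nv|v iv IH] w.
  rewrite tip_id // => -> lw; have [iw|/tip_id//] := boolP (inn w).
  by have := (tipl w).2 iw; rewrite lw ltnn.
have [iw|nw] := boolP (inn w).
  rewrite -(tip_next iv) -(tip_next iw) => tE lE; apply: nxt_inj => //.
  by apply: IH => //; rewrite !nxt_level // lE.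
rewrite (tip_id nw) => tE lE; have := (tipl v).2 iv.
by rewrite tE lE ltnn.
Qed.

End Fibres.

(** * The quotient graph and its rotation system *)

Section Quotient.
Variables (T : finType) (e : rel T) (s : {perm (T * T)}) (o : {set T * T}).
Hypotheses (esym : symmetric e) (eirr : irreflexive e).
Hypotheses (rot : rotation_system e s) (gen : genus0 e s).
Notation rev := (@rev_dart T).
Notation revK := (@rev_dartK T).
Notation face := (face_map s).
Hypotheses (o_dart : forall d, d \in o -> is_dart e d)
  (o_one : forall d d', d \in o -> d' \in o -> connect e d.1 d'.1 -> fconnect face d d').
Notation inn := (inner e o).
Variables (l : T -> nat) (nxt : T -> T).
Hypotheses (nxt_edge : forall v, inn v -> e v (nxt v))
  (nxt_level : forall v, inn v -> l (nxt v) = (l v).+1).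
Notation g := (tip inn l nxt).
Let gg (d : T * T) := (g d.1, g d.2).

Lemma connect_tip v : connect e v (g v).
Proof.
move: v; apply: (next_ind nxt_level) => [v nv|v iv IH]; first by rewrite tip_id.
rewrite -tip_next //; apply: connect_trans IH; exact/connect1/nxt_edge.
Qed.

Definition fibre_darts (U : {set T}) : {set T * T} :=
  [set d | (d.1 \in U) && (d.2 == nxt d.1) || (d.2 \in U) && (d.1 == nxt d.2)].

Lemma fibre_darts_sym U : symset rev (fibre_darts U).
Proof. by move=> d; rewrite !inE orbC. Qed.

(** The lowest vertex [u] of [U] is put back last. No other fibre edge of [U] ends at [u], so the
    darts at [u] are still a stable set without the darts at [nxt u], and the new edge merges two
    orbits. *)
Lemma fibre_orbits n (U : {set T}) : #|U| <= n -> {in U, forall v, inn v} ->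
  (forall z, porbit s z \subset porbit (phi s revK (fibre_darts U)) z) /\
  {in U, forall u, (nxt u, u) \in porbit (phi s revK (fibre_darts U)) (u, nxt u)}.
Proof.
elim: n U => [|n IH] U le Uin.
  have -> : U = set0 by apply/eqP; rewrite -cards_eq0 -leqn0.
  have -> : fibre_darts set0 = set0 by apply/setP=> d; rewrite !inE.
  by rewrite phi0; split=> // u; rewrite inE.
have [U0|[u0 u0U]] := set_0Vmem U; first by apply: IH => //; rewrite U0 cards0.
pose u := [arg min_(u < u0 in U) l u].
have [uU umin] : u \in U /\ forall w, w \in U -> l u <= l w.
  by rewrite /u; case: arg_minnP.
have iu := Uin u uU; have lu := nxt_level iu.
have cU' : #|U :\ u| <= n by move: le; rewrite (cardsD1 u) uU.
have [|sub' con'] := IH _ cU'; first by move=> w /setD1P[_ /Uin].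
set F := fibre_darts U; set F' := fibre_darts (U :\ u) in sub' con' *.
have Fsym := @fibre_darts_sym (U :\ u).
have uNF w : (u, w) \notin F'.
  rewrite !inE /= eqxx /=; apply/negP=> /andP[/andP[_ wU] /eqP E].
  by have := umin w wU; rewrite E nxt_level ?Uin //; clear; lia.
have FE : F = F' :|: [set (u, nxt u); rev (u, nxt u)].
  apply/setP=> -[a b]; rewrite !inE !xpair_eqE /=.
  case: (eqVneq a u) (eqVneq b u) => [->|au] [->|bu]; rewrite ?uU ?andbT ?andbF ?orbF //=.
  by rewrite orbC.
have dar : is_dart e (u, nxt u) by apply: nxt_edge.
have npo : (u, nxt u) \notin porbit (phi s revK F') (rev (u, nxt u)).
  rewrite porbit_sym; pose X := [set d | is_dart e d && (d.1 == u)].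
  have st : stable (phi s revK F') X.
    move=> [a b]; rewrite !inE => /andP[ab /= /eqP Ea]; subst a.
    by rewrite phiE // (negPf (uNF b)) (rot_dart rot) ?(rot_fst rot) /=.
  apply/negP=> /(stable_porbit st); rewrite !inE dar eqxx => /(_ isT)/andP[_ /= /eqP E].
  by move: lu; rewrite E; clear; lia.
have nd : (u, nxt u) != rev (u, nxt u) by rewrite eq_sym (rev_dart_neq eirr).
have [_ sub mem] := tperm_merge nd npo; rewrite -phi_edge ?uNF // -FE in sub mem.
split=> [z|w wU]; first exact: subset_trans (sub' z) (sub z).
have [->//|wu] := eqVneq w u.
by apply/(subsetP (sub _))/con'; rewrite !inE wu.
Qed.

Notation M := (fibre_darts [set v | inn v]).
Notation pM := (phi s revK M).

Lemma fibre_dart d : d \in M -> is_dart e d /\ g d.1 = g d.2.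
Proof.
rewrite !inE => /orP[]/andP[i /eqP E]; rewrite /is_dart E.
  by rewrite nxt_edge // tip_next.
by rewrite esym nxt_edge // tip_next.
Qed.

Lemma pM_fst d : g (pM d).1 = g d.1.
Proof.
rewrite phiE; last exact: fibre_darts_sym.
case: ifP => [/fibre_dart[dd ->]|_].
  by rewrite (rot_fst rot) ?is_dart_rev.
have [dd|nd] := boolP (is_dart e d); first by rewrite (rot_fst rot).
by case: rot => /(_ d nd) -> _ _.
Qed.

(** Each edge of a fibre joins the orbits at its two ends, so all darts at the fibre share an orbit
    with those at its tip. By [pM_fst], orbits do not leave the fibre. *)
Lemma fibre_porbit d d' : is_dart e d -> is_dart e d' -> g d.1 = g d'.1 ->
  d' \in porbit pM d.
Proof.
have [|sub con] := fibre_orbits (leqnn _) (U := [set v | inn v]).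
  by move=> v; rewrite inE.
have atv a b : is_dart e a -> is_dart e b -> a.1 = b.1 -> porbit pM b = porbit pM a.
  by move=> da db ab; apply/porbit_eqP/(subsetP (sub _))/(rot_porbit rot).
have P v a b : is_dart e a -> is_dart e b -> a.1 = v -> b.1 = g v -> porbit pM b = porbit pM a.
  move: v a b; apply: (next_ind nxt_level (P := fun v => forall a b, _)) => [v nv|v iv IH] a b da db av bv.
    by apply: atv => //; rewrite av bv tip_id.
  have vn := nxt_edge iv.
  rewrite -(atv a (v, nxt v) da vn av).
  have /con/porbit_eqP <- : v \in [set v | inn v] by rewrite inE.
  by apply: IH => //; [rewrite /is_dart /= esym | rewrite tip_next].
move=> dd dd' E; have [w gw] : exists w, e (g d.1) w.
  apply: (comp_nonisolated esym (v := d.1)); first by exists d.2.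
  by rewrite in_comp connect_tip.
apply/porbit_eqP; rewrite -(P d.1 d (g d.1, w) dd gw erefl erefl).
by rewrite (P d'.1 d' (g d.1, w) dd' gw erefl E).
Qed.

(** A path is represented by its tip, so the quotient lives on [T] itself and the inner vertices
    become isolated. Being a relation, it has no parallel edges. *)
Definition quotient_rel : rel T := fun a b =>
  (a != b) && [exists d, [&& is_dart e d, g d.1 == a & g d.2 == b]].
Notation eH := quotient_rel.
Notation dartH := (is_dart eH).

Lemma quotient_sym : symmetric eH.
Proof.
move=> a b; rewrite /eH eq_sym; congr (_ && _).
by apply/existsP/existsP=> -[d /and3P[dd da db]]; exists (rev d); rewrite is_dart_rev // dd da db.
Qed.

Lemma quotient_irr : irreflexive eH.
Proof. by move=> a; rewrite /eH eqxx. Qed.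

Definition pick_dart (h : T * T) :=
  odflt h [pick d | [&& is_dart e d, g d.1 == h.1 & g d.2 == h.2]].

(* A dart of [e] for each dart of the quotient, so that opposite darts get
   opposite representatives; the junk value [(x, x)] is not a dart. *)
Definition rep h := if dartH h then
  if enum_rank h.1 < enum_rank h.2 then pick_dart h else rev (pick_dart (rev h)) else (h.1, h.1).

Lemma repP h : dartH h -> is_dart e (rep h) /\ gg (rep h) = h.
Proof.
have pk a b : dartH (a, b) -> is_dart e (pick_dart (a, b)) /\ gg (pick_dart (a, b)) = (a, b).
  case/andP=> _ /existsP[d dP]; rewrite /pick_dart; case: pickP => [d' /=|/(_ d)]; last by rewrite dP.
  by rewrite /gg => /and3P[dd /eqP-> /eqP->].
case: h => a b dh; rewrite /rep dh; case: ifP => _; first exact: pk.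
have [|dd] := pk b a; first by rewrite /is_dart /= quotient_sym.
by rewrite is_dart_rev // /gg /= => -[-> ->].
Qed.

Lemma rep_rev h : dartH h -> rep (rev h) = rev (rep h).
Proof.
move=> dh; rewrite /rep is_dart_rev ?dh; last exact: quotient_sym.
case: h dh => a b /andP[ab _]; rewrite [(rev _).1]/= [(rev _).2]/=; case: ltngtP => E; rewrite ?revK //.
by move: ab; rewrite (enum_rank_inj (val_inj E)) eqxx.
Qed.

Definition reps : {set T * T} := [set rep h | h in [set h | dartH h]].
Notation R := reps.

Lemma rep_reps h : dartH h -> rep h \in R.
Proof. by move=> dh; apply: imset_f; rewrite inE. Qed.

Lemma repsP d : d \in R -> [/\ is_dart e d, dartH (gg d) & rep (gg d) = d].
Proof. by case/imsetP=> h; rewrite inE => dh ->; have [dd ->] := repP dh. Qed.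

Lemma reps_sym : symset rev R.
Proof.
by move=> d /repsP[dd dh <-]; rewrite -rep_rev // rep_reps // is_dart_rev //; apply: quotient_sym.
Qed.

Lemma reps_fibre d : d \in R -> d \notin M.
Proof.
case/repsP=> _ + _; apply: contraL => /fibre_dart[_ E].
by rewrite /gg /is_dart /= E quotient_irr.
Qed.

(* Contracting the fibres merges the rotations at their vertices into the orbits
   of [pM]; only the representatives are kept. *)
Definition quotient_fun h := if dartH h then gg (ret R pM (rep h)) else h.

Lemma quotient_fun_dart h : dartH h ->
  dartH (quotient_fun h) /\ rep (quotient_fun h) = ret R pM (rep h).
Proof.
move=> dh; rewrite /quotient_fun dh.
by have [/repsP[]] := retP pM (rep_reps dh).
Qed.

Lemma quotient_fun_inj : injective quotient_fun.
Proof.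
move=> x y; have [dx|dx] := boolP (dartH x); have [dy|dy] := boolP (dartH y).
- have [_ rx] := quotient_fun_dart dx; have [_ ry] := quotient_fun_dart dy => E.
  have := ret_inj (p := pM) (rep_reps dx) (rep_reps dy); rewrite -rx -ry E => /(_ erefl) E'.
  by have [_ <-] := repP dx; have [_ <-] := repP dy; rewrite E'.
- have [+ _] := quotient_fun_dart dx; rewrite {3}/quotient_fun (negPf dy) => + E.
  by rewrite E (negPf dy).
- have [+ _] := quotient_fun_dart dy; rewrite {2}/quotient_fun (negPf dx) => + E.
  by rewrite -E (negPf dx).
by rewrite /quotient_fun (negPf dx) (negPf dy).
Qed.

Definition quotient_rot : {perm (T * T)} := perm quotient_fun_inj.
Notation sH := quotient_rot.

Lemma rep_rot h : dartH h -> dartH (sH h) /\ rep (sH h) = ret R pM (rep h).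
Proof. by rewrite permE; apply: quotient_fun_dart. Qed.

Lemma rep_fconnect (f p : T * T -> T * T) h h' :
  (forall h, dartH h -> dartH (f h) /\ rep (f h) = p (rep h)) ->
  dartH h -> dartH h' -> fconnect f h h' = fconnect p (rep h) (rep h').
Proof.
move=> fp dh dh'; have E n : dartH (iter n f h) /\ rep (iter n f h) = iter n p (rep h).
  by elim: n => //= n [dn <-]; apply: fp.
apply/idP/idP => /iter_findex; set n := findex _ _ _ => En.
  by rewrite -En (E n).2 fconnect_iter.
have <- : iter n f h = h'; last exact: fconnect_iter.
by have [_ <-] := repP (E n).1; have [_ <-] := repP dh'; rewrite (E n).2 En.
Qed.

Lemma quotient_rotation : rotation_system eH sH.
Proof.
split=> [h nh|h dh|h h' dh dh' hh'].
- by rewrite permE /quotient_fun (negPf nh).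
- have [dd E] := rep_rot dh; split=> //.
  have [_ <-] := repP dd; rewrite E; have [_ {2}<-] := repP dh.
  have [_ [k [-> _]]] := retP pM (rep_reps dh); rewrite /gg /=.
  by rewrite pM_fst; elim: k => //= k; rewrite pM_fst.
rewrite (rep_fconnect rep_rot) // -ret_orbit ?rep_reps //.
have [dd E] := repP dh; have [dd' E'] := repP dh'.
by apply: fibre_porbit => //; move: hh'; rewrite -{1}E -{1}E'.
Qed.

Notation pA := (phi s revK (M :|: R)).

Lemma fibre_reps_sym : symset rev (M :|: R).
Proof. by apply: symsetU; [apply: fibre_darts_sym | apply: reps_sym]. Qed.

Lemma pA_fibre : {in ~: R, pM =1 pA}.
Proof.
move=> d; rewrite inE => dR; rewrite !phiE ?inE ?(negPf dR) ?orbF //.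
  exact: fibre_reps_sym.
exact: fibre_darts_sym.
Qed.

(** [pM] and [pA] agree outside [R], and on [R] only [pA] reverses the dart first. So returning
    under [pM] from the reversed dart is returning under [pA] from the dart. *)
Lemma rep_face h : dartH h -> dartH (face_map sH h) /\ rep (face_map sH h) = ret R pA (rep h).
Proof.
move=> dh; have dr : dartH (rev h) by rewrite is_dart_rev //; apply: quotient_sym.
have [dd ->] := rep_rot dr; split=> //; rewrite rep_rev // /ret (hit_eq _ _ pA_fibre).
have rR := rep_reps dh; congr (hit _ _ _ _); rewrite !phiE; first last.
- exact: fibre_darts_sym.
- exact: fibre_reps_sym.
by rewrite (negPf (reps_fibre (reps_sym rR))) in_setU rR orbT.
Qed.

Lemma comp_tip a v : (g v \in comp e a) = (v \in comp e a).
Proof. by rewrite !in_comp; symmetry; apply: (same_connect_r (csym esym)); apply: connect_tip. Qed.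

Lemma quotient_edge x y : e x y -> g x = g y \/ eH (g x) (g y).
Proof.
move=> xy; case: (eqVneq (g x) (g y)) => [->|ne]; [by left|right].
by apply/andP; split=> //; apply/existsP; exists (x, y); apply/and3P; split.
Qed.

(** * Euler's formula and the outer face in a component of the quotient *)

Section Component.
Variable a : T.
Hypothesis na : exists w, eH a w.
Notation C := (comp e a).
Notation E := (comp_darts e a).
Notation EH := (comp_darts eH a).

Lemma quotient_noninner x y : eH x y -> ~~ inn x /\ ~~ inn y.
Proof. by case/andP=> _ /existsP[d /and3P[_ /eqP<- /eqP<-]]; split; apply: tip_noninner. Qed.

Lemma comp_quotient w : (w \in comp eH a) = (w \in C) && ~~ inn w.
Proof.
have [b ab] := na; have [nia _] := quotient_noninner ab.
rewrite !in_comp; apply/idP/andP => [aw|[aw nw]].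
  apply: (connect_ind (P := fun w => connect e a w /\ ~~ inn w)) aw _ => // x y xy [ax _].
  split; last by case: (quotient_noninner xy).
  case/andP: xy => _ /existsP[d /and3P[dd /eqP gx /eqP gy]].
  rewrite -in_comp -gy comp_tip -(comp_edge esym _ dd) -comp_tip gx in_comp.
  exact: ax.
rewrite -(tip_id l nxt nw) -(tip_id l nxt nia).
apply: (connect_ind (P := fun w => connect eH (g a) (g w))) aw _ => // x y xy ax.
by case: (quotient_edge xy) => [<-//|xy']; apply: connect_trans ax (connect1 xy').
Qed.

Lemma comp_darts_quotient h : dartH h -> (h \in EH) = (rep h \in E).
Proof.
move=> dh; rewrite !inE; have [dd Eh] := repP dh; rewrite dh dd -in_comp comp_quotient.
by rewrite (quotient_noninner dh).1 andbT -{1}Eh comp_tip in_comp.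
Qed.

Let AE := (M :|: R) :&: E.

Lemma comp_fibre_reps_sym : symset rev AE.
Proof. by move=> d; rewrite !in_setI => /andP[/fibre_reps_sym-> /(comp_darts_rev esym)->]. Qed.

Lemma pA_comp : {in E, phi s revK AE =1 pA}.
Proof.
move=> d dE; rewrite !phiE ?in_setI ?dE ?andbT //; first exact: fibre_reps_sym.
exact: comp_fibre_reps_sym.
Qed.

Lemma comp_nontrivial : exists w, e a w.
Proof.
have [b /andP[_ /existsP[d /and3P[dd /eqP ga _]]]] := na.
by apply: (comp_nonisolated esym (v := d.1)); [exists d.2 | rewrite -ga in_comp connect_tip].
Qed.

(** The property that [X] contains all darts at a vertex spreads along each fibre, and along
    representatives between adjacent fibres; every edge of [e] stays in a fibre or joins two fibres
    that have a representative. *)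
Lemma fibres_connected (X : {set T * T}) : X \subset E -> X != set0 -> stable s X ->
  (forall d, d \in AE -> d \in X -> rev d \in X) -> X = E.
Proof.
move=> XE /set0Pn[d0 d0X] st cl.
have XEd d : d \in X -> is_dart e d /\ d.1 \in C.
  by move/(subsetP XE); rewrite inE => /andP[].
pose P v := forall d, is_dart e d -> d.1 = v -> d \in X.
have P1 d : d \in X -> P d.1.
  move=> dX d' dd' E; apply: (stable_porbit st dX).
  by apply: (rot_porbit rot) => //; case: (XEd _ dX).
have cross d : is_dart e d -> d.1 \in C -> d \in M :|: R -> P d.1 -> P d.2.
  move=> dd dC dA Pd; have dX := Pd d dd erefl.
  apply: (P1 (rev d)); apply: cl => //; rewrite in_setI dA.
  exact: (subsetP XE).
have Ptip v : v \in C -> P v <-> P (g v).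
  move: v; apply: (next_ind nxt_level) => [v nv|v iv IH] vC; first by rewrite tip_id.
  have vn := nxt_edge iv; have nC : nxt v \in C by rewrite -(comp_edge esym _ vn).
  rewrite -tip_next // -(IH nC).
  have vM : (v, nxt v) \in M :|: R by rewrite in_setU !inE /= iv eqxx.
  split; first by apply: (cross (v, nxt v)).
  by apply: (cross (nxt v, v)) => //; [rewrite /is_dart /= esym | apply: (fibre_reps_sym vM)].
have [d0d d0C] := XEd _ d0X.
have all v : v \in C -> P v.
  rewrite in_comp => av.
  have dv : connect e d0.1 v by move: d0C; rewrite in_comp csym // => /connect_trans; apply.
  suff [] : v \in C /\ P v by [].
  apply: (connect_ind (P := fun v => v \in C /\ P v)) dv _; last by split=> //; apply: P1.
  move=> x y xy [xC Px]; have yC : y \in C by rewrite -(comp_edge esym _ xy).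
  split=> //; apply/(Ptip y yC); move/(Ptip x xC): Px => Pgx.
  case: (quotient_edge xy) => [<-//|dh].
  have [dd [g1 g2]] := repP (h := (g x, g y)) dh.
  have rC : (rep (g x, g y)).1 \in C by rewrite -comp_tip g1 comp_tip.
  have rC2 : (rep (g x, g y)).2 \in C by rewrite -comp_tip g2 comp_tip.
  rewrite -g2; apply/(Ptip _ rC2); apply: cross => //.
    by rewrite in_setU rep_reps ?orbT.
  by apply/(Ptip _ rC); rewrite g1.
apply/eqP; rewrite eqEsubset XE; apply/subsetP=> d; rewrite inE => /andP[dd dC].
exact: all dC d dd erefl.
Qed.

Lemma comp_submap : 2 * cyc pA E + 2 * cyc s E = #|AE| + 4 /\
  forall z, z \in E -> porbit (phi s revK E) z \subset porbit pA z.
Proof.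
have symE := comp_darts_rev esym (v := a); have stE := comp_darts_rot rot (v := a).
have AE_E : AE \subset E by apply: subsetIr.
have stA := phi_stable revK comp_fibre_reps_sym symE AE_E stE.
rewrite -(cyc_eq_in stA pA_comp).
have [||c sub] := connected_submap (rK := revK) comp_fibre_reps_sym symE AE_E stE _ _ fibres_connected.
- by move=> d; rewrite inE => /andP[/(rev_dart_neq eirr)].
- rewrite -comp_faces_cyc // -comp_cyc //; last exact: comp_nontrivial.
  by rewrite addnC ![2 * _]mulnC; apply: gen comp_nontrivial.
split=> // z zE; rewrite -(porbit_eq_in stA pA_comp zE); exact: sub.
Qed.

Lemma pA_stable : stable pA E.
Proof.
move=> d dE; rewrite -pA_comp //; apply: (phi_stable revK comp_fibre_reps_sym) => //.
- exact: comp_darts_rev.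
- exact: subsetIr.
exact: comp_darts_rot.
Qed.

(* A face all of whose darts are markers would be all of a fibre, but every
   fibre has representatives. *)
Lemma face_hits_reps d : d \in E ->
  exists z, [/\ z \in R, z \in E, z \in porbit pA d & g z.1 = g d.1].
Proof.
move=> dE; have [dd dC] : is_dart e d /\ d.1 \in C by move: dE; rewrite inE => /andP[].
have [b gb] : exists b, eH (g d.1) b.
  apply: (comp_nonisolated quotient_sym na).
  by rewrite comp_quotient comp_tip dC tip_noninner.
have [rd [rg _]] := repP (h := (g d.1, b)) gb; have rR := rep_reps (h := (g d.1, b)) gb.
have [/exists_inP[y yd yR]|no] := boolP [exists y in porbit pA d, y \in R]; last first.
  have Epo : porbit pA d = porbit pM d.
    apply: (@porbit_eq_in _ _ _ (porbit pA d)); last exact: porbit_id.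
      by move=> y /porbit_eqP yd; apply/porbit_eqP; rewrite porbit_step.
    move=> y yd; rewrite pA_fibre // inE; apply: contra no => yR.
    by apply/exists_inP; exists y.
  case/negP: no; apply/exists_inP; exists (rep (g d.1, b)) => //.
  by rewrite Epo; apply: fibre_porbit.
have /porbitP[i Ei] := yd; rewrite permX in Ei.
have [|k [_ -> kR kj]] := hitP (R := R) (p := pA) (x := d) (ltnSn i); first by rewrite -Ei.
have kd : iter k pA d \in porbit pA d by rewrite -permX mem_porbit.
exists (iter k pA d); split=> //; first exact: stable_porbit pA_stable dE kd.
elim: k kj {kR kd} => //= k IH kj; rewrite -(pA_fibre (x := iter k pA d)).
  by rewrite pM_fst IH // => j jk; apply: kj; apply: leqW.
by rewrite inE kj.
Qed.

(** A face of the quotient is the trace on [R] of an orbit of [pA], and every such orbit meets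
    [R]. *)
Lemma quotient_faces : comp_faces eH sH a = cyc pA E.
Proof.
rewrite (comp_faces_cyc quotient_sym quotient_rotation).
have symH := comp_darts_rev quotient_sym (v := a).
have stH : stable (phi sH revK EH) EH.
  by apply: phi_stable => //; apply: (comp_darts_rot quotient_rotation).
have phiH : {in EH, phi sH revK EH =1 face_map sH}.
  by move=> h hE; rewrite phiE // hE.
have dartE h : h \in EH -> dartH h by rewrite inE => /andP[].
symmetry; apply: (card_imset_transfer (h := rep)) => [h hE|h h' hE hE'|d dE].
- by rewrite -comp_darts_quotient // dartE.
- have dh := dartE _ hE; have dh' := dartE _ hE'.
  suff Eq : (h' \in porbit (phi sH revK EH) h) = (rep h' \in porbit pA (rep h)).
    by split=> /porbit_eqP; [rewrite porbit_sym Eq|rewrite porbit_sym -Eq];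
      rewrite porbit_sym => /porbit_eqP.
  rewrite porbit_fconnect (fconnect_eq_in _ stH phiH hE).
  by rewrite (rep_fconnect rep_face) // -ret_orbit ?rep_reps.
have [z [zR zE zd _]] := face_hits_reps dE; have [_ dz rz] := repsP zR.
exists (gg z); first by rewrite comp_darts_quotient ?rz.
by rewrite rz; symmetry; apply/porbit_eqP.
Qed.

Lemma quotient_darts : #|EH| = #|R :&: E|.
Proof.
have dartE h : h \in EH -> dartH h by rewrite inE => /andP[].
rewrite -(card_in_imset (f := rep) (D := mem EH)); last first.
  by move=> h h' /dartE/repP[_ {2}<-] /dartE/repP[_ {2}<-] ->.
apply: eq_card => d; rewrite in_setI; apply/imsetP/andP => [[h hE ->]|[dR dE]].
  by rewrite -comp_darts_quotient ?rep_reps ?dartE.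
have [_ dh rd] := repsP dR.
by exists (gg d); rewrite ?comp_darts_quotient ?rd.
Qed.

Lemma card_fibre_darts : #|M :&: E| = 2 * #|C :&: [set v | inn v]|.
Proof.
set I := C :&: _; pose up v := (v, nxt v).
have II v : v \in I -> v \in C /\ inn v by rewrite !inE => /andP[].
have upI : injective up by move=> v w [].
have reI : injective (rev \o up) by move=> v w [].
have -> : M :&: E = up @: I :|: (rev \o up) @: I.
  apply/setP=> -[x y]; rewrite in_setI in_setU; apply/andP/orP.
    case=> xyM; rewrite inE => /andP[xy xC]; have := comp_edge esym a xy; rewrite xC => yC.
    move: xyM; rewrite !inE /= => /orP[]/andP[i /eqP->]; [left|right].
      by apply/imsetP; exists x; rewrite // !inE i andbT -in_comp.
    by apply/imsetP; exists y; rewrite // !inE i andbT -in_comp -yC.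
  have inE v : v \in I -> up v \in M /\ up v \in E.
    move=> /II[vC iv]; rewrite !inE /= iv eqxx /is_dart /= nxt_edge //=.
    by rewrite -in_comp.
  case=> /imsetP[v /inE[vM vE] ->]; split=> //=; first exact: fibre_darts_sym.
  exact: comp_darts_rev.
rewrite cardsU !card_imset // (_ : _ :&: _ = set0) ?cards0 ?subn0 ?addnn ?mul2n //.
apply/setP=> d; rewrite !inE; apply/negP=> /andP[/imsetP[v /II[_ iv] ->] /imsetP[w /II[_ iw] [E1 E2]]].
by have := nxt_level iv; have := nxt_level iw; rewrite -E1 E2; clear; lia.
Qed.

(** Compared with the submap of [comp_submap], contraction loses one vertex and one edge for each
    inner vertex and keeps the number of faces. *)
Lemma quotient_euler : #|comp eH a| * 2 + comp_faces eH sH a * 2 = #|EH| + 4.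
Proof.
have [c _] := comp_submap; move: c; rewrite quotient_faces quotient_darts.
have -> : #|AE| = 2 * #|C :&: [set v | inn v]| + #|R :&: E|.
  rewrite -card_fibre_darts /AE setIUl cardsU (_ : (M :&: E) :&: (R :&: E) = set0) ?cards0 ?subn0 //.
  apply/setP=> d; rewrite !inE; apply/negP=> /andP[/andP[dM _] /andP[/reps_fibre]].
  by rewrite !inE dM.
have -> : #|comp eH a| = #|C :\: [set v | inn v]|.
  by apply: eq_card => w; rewrite comp_quotient in_setD inE andbC.
rewrite -(comp_cyc esym rot comp_nontrivial) -(cardsID [set v | inn v] C).
move: #|C :&: _| #|C :\: _| (cyc _ _) #|R :&: E|; clear; lia.
Qed.

(** Every tip is on the outer face of the component, all of whose darts lie in one orbit of [pA] by
    [comp_submap]. The corresponding face of the quotient therefore visits every vertex. *)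
Lemma quotient_outer : exists d, dartH d /\ forall w, w \in comp eH a ->
  exists d', fconnect (face_map sH) d d' /\ d'.1 = w.
Proof.
have od w : w \in comp eH a -> exists d, d \in o /\ d.1 = w.
  rewrite comp_quotient => /andP[wC]; have [x wx] := comp_nonisolated esym comp_nontrivial wC.
  rewrite /inner (introT existsP (ex_intro _ x wx)) negbK.
  by case/exists_inP=> d dO /eqP; exists d.
(* An outer dart at [w] need not be a representative; following [pA] from it reaches one that still
   starts in the fibre of [w]. *)
have hit w : w \in comp eH a -> exists d z, [/\ d \in o, d \in E, z \in R, z \in porbit pA d & g z.1 = w].
  move=> wH; have [d [dO dw]] := od w wH; move: wH; rewrite comp_quotient => /andP[wC nw].
  have dE : d \in E by rewrite inE o_dart // dw.
  have [z [zR zE zd gz]] := face_hits_reps dE; exists d, z; split=> //.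
  by rewrite gz dw tip_id.
have aH : a \in comp eH a by rewrite in_comp connect0.
have [d0 [z0 [d0O d0E z0R z0d0 _]]] := hit a aH.
have [_ sub] := comp_submap; have [_ dz0 rz0] := repsP z0R; exists (gg z0); split=> // w wH.
have [d [z [dO dE zR zd gz]]] := hit w wH; have [_ dz rz] := repsP zR.
exists (gg z); split=> //; rewrite (rep_fconnect rep_face) // rz0 rz -ret_orbit //.
apply/porbit_eqP; move/porbit_eqP: zd => ->; move/porbit_eqP: z0d0 => ->.
apply/porbit_eqP/(subsetP (sub _ d0E)); rewrite porbit_fconnect.
have symE := comp_darts_rev esym (v := a).
have stE : stable (phi s revK E) E by apply: phi_stable => //; apply: comp_darts_rot.
rewrite (fconnect_eq_in _ stE (g := face)) // => [|x xE]; last by rewrite phiE // xE.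
apply: o_one => //; move: d0E dE; rewrite !inE => /andP[_ ad0] /andP[_]; apply: connect_trans.
by rewrite csym.
Qed.

End Component.

Lemma quotient_outerplanar : outerplanar eH.
Proof.
split; first by split; [exact: quotient_sym | exact: quotient_irr].
exists sH; split; last by move=> v nv; have [d [dd dP]] := quotient_outer nv; exists d.
by split; [exact: quotient_rotation | move=> v nv; exact: quotient_euler].
Qed.

End Quotient.

Theorem theorem1 (T : finType) (e : rel T) :
  squaregraph e ->
  exists (TH : finType) (eH : rel TH) (n : nat) (f : T -> TH * 'I_n),
    [/\ outerplanar eH, injective f &
        forall x y, e x y -> semistrong eH (@path_graph n) (f x) (f y)].
Proof.
case=> [[esym eirr] [s [o [[rot gen] [o_dart [o_face o_one o_each quad inner_deg]]]]]].
have [l [lstep ltop]] := squaregraph_levels esym eirr rot gen o_dart o_face o_one o_each quad inner_deg.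
have /fin_all_exists[nxt nxtP] v : exists x, inner e o v -> next_spec e s l v x.
  (* The value [v] at a vertex that is not inner is a mere default. *)
  have [iv|nv] := boolP (inner e o v); last by exists v.
  by have [x xP] := next_exists rot inner_deg lstep ltop iv; exists x.
have nxt_edge v : inner e o v -> e v (nxt v) by case/nxtP.
have nxt_level v : inner e o v -> l (nxt v) = (l v).+1 by case/nxtP.
have nxt_inj : {in inner e o &, injective nxt}.
  move=> a b ia ib E; apply: (next_inj esym rot inner_deg ltop ia ib (nxtP _ ia)).
  by rewrite E; apply: nxtP.
pose g := tip (inner e o) l nxt.
have lP v : l v < (\max_v l v).+1 by rewrite ltnS (leq_bigmax (F := l)).
exists T, (quotient_rel e o l nxt), (\max_v l v).+1, (fun v => (g v, Ordinal (lP v))).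
split.
- exact: (quotient_outerplanar esym eirr rot gen o_dart o_one nxt_edge nxt_level).
- by move=> x y [gE lE]; apply: (tip_inj nxt_level nxt_inj gE lE).
move=> x y xy; have lxy : path_graph (Ordinal (lP x)) (Ordinal (lP y)).
  by rewrite /path_graph /=; case: (lstep x y xy) => ->; rewrite eqxx ?orbT.
(* The levels are always adjacent in the path, so equal and adjacent tips match the two cases of the
   product. *)
by rewrite /semistrong /= lxy !andbT /g; case: (quotient_edge o l nxt xy) => [->|->]; rewrite ?eqxx ?orbT.
Qed.
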